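(* Let $T\ge 1$ be an integer and $\delta\in(0,1)$. Let $f:\mathbb{R}^d\to\mathbb{R}$ be $(L_0,L_1)$-smooth and suppose that Assumptions 1, 2 and 3 (bounded below, unbiased gradient oracle, almost-sure relaxed affine variance with constants $A,B,C>0$) hold. Let $\{\overline{x}_t\}_{t\in[T]}$ be generated by SGD or by RSAG with the constant step size $$\theta_t=\eta=\min\left\{\frac{1}{\mathcal{A}\sqrt{T}},\frac{1}{\mathcal{B}},\frac{1}{\mathcal{C}\sqrt{T}},\frac{1}{\mathcal{G}},\frac{\overline{\Delta}_c^{-1/2}}{3(A+4BL_0)},\frac{\overline{\Delta}_c^{-3/2}}{12BL_1^2}\right\},$$ where, with $\overline{\Delta}_1=f(x_1)-f^*$, $$\overline{\Delta}_c=8\overline{\Delta}_1+8+32\log^2\frac{T}{\delta}+\frac{8\sqrt{2C}}{\sqrt{L_0T}}\log\frac{T}{\delta}+\frac{303L_0}{224L_1^2},\qquad \mathcal{M}_c=\frac{L_0}{8L_1}+\frac94\sqrt{L_0\overline{\Delta}_c+L_1^2\overline{\Delta}_c^2},$$ $$\mathcal{A}=4\sqrt{(L_0+L_1\mathcal{M}_c)A},\quad \mathcal{B}=8(L_0+L_1\mathcal{M}_c)(B+1),\quad \mathcal{C}=2\sqrt{(L_0+L_1\mathcal{M}_c)C},$$ $$\mathcal{G}=8L_1\left(\sqrt{A\overline{\Delta}_c}+2(\sqrt{B}+1)\sqrt{L_0\overline{\Delta}_c+L_1^2\overline{\Delta}_c^2}+\sqrt{C}\right).$$ Then, with probability at least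 $1-\delta$, $$\begin{aligned}\frac1T\sum_{t=1}^T\|\nabla f(\overline{x}_t)\|^2\le{}&\frac{4}{\sqrt T}\sqrt{L_0+L_1\mathcal{M}_c}\left(\sqrt{A}(\overline{\Delta}_c+4\overline{\Delta}_1)+2\sqrt{C}(1+\overline{\Delta}_1)\right)+\frac{32\overline{\Delta}_1}{T}(L_0+L_1\mathcal{M}_c)(B+1)\\&+\frac{12\overline{\Delta}_1}{T}\left((A+4BL_0)\overline{\Delta}_c^{1/2}+4BL_1^2\overline{\Delta}_c^{3/2}\right)\\&+\frac{32\overline{\Delta}_1}{T}L_1\left(\sqrt{A\overline{\Delta}_c}+2(\sqrt B+1)\sqrt{L_0\overline{\Delta}_c+L_1^2\overline{\Delta}_c^2}+\sqrt C\right)\\&+\frac{12}{T}\left(A\overline{\Delta}_c+4B(L_0\overline{\Delta}_c+L_1^2\overline{\Delta}_c^2)+C\right)\log\frac T\delta .\end{aligned}$$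
   Context: Notation: $\|\cdot\|$ is the Euclidean norm on $\mathbb{R}^d$, $[T]=\{1,\dots,T\}$, $\log$ is the natural logarithm. The objective is $f(x)=\mathbb{E}_{z\sim\mathcal D}[f_z(x;z)]$, differentiable, with stochastic gradient oracle $\nabla f_z(x;z)$; $z_1,\dots,z_T$ are independent samples from $\mathcal D$. $(L_0,L_1)$-smoothness ($L_0,L_1>0$): $\|\nabla f(x)-\nabla f(y)\|\le (L_0+L_1\|\nabla f(x)\|)\|x-y\|$ for all $x,y\in\mathbb{R}^d$ with $\|x-y\|\le 1/L_1$. Assumption 1: $f^*:=\inf_{x}f(x)>-\infty$. Assumption 2: $\mathbb{E}_z[\nabla f_z(x;z)]=\nabla f(x)$ for all $x$. Assumption 3: for constants $A,B,C>0$, for all $x$, almost surely $\|\nabla f_z(x;z)-\nabla f(x)\|^2\le A(f(x)-f^* )+B\|\nabla f(x)\|^2+C$. Generic AGD template: given (deterministic) $\tilde x_1=x_1\in\mathbb{R}^d$, $\alpha_t\in(0,1]$ and step sizes $\theta_t,\gamma_t$, for $t=1,\dots,T$: $\overline{x}_t=\alpha_tx_t+(1-\alpha_t)\tilde x_t$; $g_t=\nabla f_z(\overline{x}_t;z_t)$; $x_{t+1}=x_t-\theta_tg_t$; $\tilde x_{t+1}=\overline{x}_t-\gamma_tg_t$. RSAG with constant step size: $\theta_t=\eta$ constant, $\alpha_t=\frac{2}{t+1}$, $\gamma_t=(1+\alpha_t)\theta_t$. SGD: $\theta_t=\gamma_t=\eta$ constant (so $\overline{x}_t=x_t$). *)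

(* Defs.v *)
From HB Require Import structures.
From mathcomp Require Import all_boot all_order all_algebra finmap.
From mathcomp Require Import all_classical all_reals all_analysis.

Set Implicit Arguments.
Unset Strict Implicit.
Unset Printing Implicit Defensive.

Import Order.TTheory GRing.Theory Num.Theory.
Import numFieldNormedType.Exports.

Local Open Scope classical_set_scope.
Local Open Scope ring_scope.

(* The library's norm `|v| on 'rV[R]_d is the sup norm, hence enorm. *)
Definition enorm (R : realType) (d : nat) (v : 'rV[R]_d) : R :=
  Num.sqrt (\sum_(i < d) v 0 i ^+ 2).

Definition grad (R : realType) (d : nat) (f : 'rV[R]_d -> R) (x : 'rV[R]_d) :
    'rV[R]_d :=
  \row_(i < d) 'D_(delta_mx 0 i) f x.

Definition L0L1_smooth (R : realType) (d : nat) (L0 L1 : R)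
    (f : 'rV[R]_d -> R) : Prop :=
  forall x y : 'rV[R]_d, enorm (x - y) <= 1 / L1 ->
    enorm (grad f x - grad f y) <= (L0 + L1 * enorm (grad f x)) * enorm (x - y).

Definition is_expectation (dZ : measure_display) (Z : measurableType dZ)
    (R : realType) (D : probability Z R) (h : Z -> R) (m : R) : Prop :=
  D.-integrable [set: Z] (EFin \o h) /\ 'E_D[h]%E = m%:E.

Definition unbiased_oracle (dZ : measure_display) (Z : measurableType dZ)
    (R : realType) (D : probability Z R) (d : nat)
    (fz : 'rV[R]_d -> Z -> R) (f : 'rV[R]_d -> R) : Prop :=
  forall (x : 'rV[R]_d) (i : 'I_d),
    is_expectation D (fun z => grad (fz ^~ z) x 0 i) (grad f x 0 i).

Definition relaxed_affine_variance (dZ : measure_display)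
    (Z : measurableType dZ) (R : realType) (D : probability Z R) (d : nat)
    (A B C : R) (fz : 'rV[R]_d -> Z -> R) (f : 'rV[R]_d -> R) : Prop :=
  forall x : 'rV[R]_d, {ae D, forall z,
    enorm (grad (fz ^~ z) x - grad f x) ^+ 2 <=
      A * (f x - inf (range f)) + B * enorm (grad f x) ^+ 2 + C}.

Definition mutually_independent (dO dZ : measure_display)
    (Omega : measurableType dO) (Z : measurableType dZ) (R : realType)
    (P : probability Omega R) (I : set nat) (X : nat -> {RV P >-> Z}) : Prop :=
  forall (J : {fset nat}) (E : nat -> set Z),
    [set` J] `<=` I -> (forall j, j \in J -> measurable (E j)) ->
    P (\bigcap_(j in [set` J]) (X j @^-1` E j)) =
      (\prod_(j <- J) P (X j @^-1` E j))%E.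

Definition iid_samples (dO dZ : measure_display)
    (Omega : measurableType dO) (Z : measurableType dZ) (R : realType)
    (P : probability Omega R) (D : probability Z R) (T : nat)
    (X : nat -> {RV P >-> Z}) : Prop :=
  mutually_independent [set t | (1 <= t <= T)%N] X /\
  (forall t, (1 <= t <= T)%N -> forall E : set Z, measurable E ->
    distribution P (X t) E = D E).

Definition agd_mid (R : realType) (d : nat) (alpha : nat -> R) (t : nat)
    (s : 'rV[R]_d * 'rV[R]_d) : 'rV[R]_d :=
  alpha t *: s.1 + (1 - alpha t) *: s.2.

(* Times start at 1: agd_iter n is the pair (x_(n+1), xtilde_(n+1)). *)
Fixpoint agd_iter (R : realType) (d : nat) (Z : Type)
    (G : 'rV[R]_d -> Z -> 'rV[R]_d) (x1 : 'rV[R]_d)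
    (alpha theta gamma : nat -> R) (z : nat -> Z) (n : nat) :
    'rV[R]_d * 'rV[R]_d :=
  if n is m.+1 then
    let s := agd_iter G x1 alpha theta gamma z m in
    let xbar := agd_mid alpha n s in
    let g := G xbar (z n) in
    (s.1 - theta n *: g, xbar - gamma n *: g)
  else (x1, x1).

Definition agd_xbar (R : realType) (d : nat) (Z : Type)
    (G : 'rV[R]_d -> Z -> 'rV[R]_d) (x1 : 'rV[R]_d)
    (alpha theta gamma : nat -> R) (z : nat -> Z) (t : nat) : 'rV[R]_d :=
  agd_mid alpha t (agd_iter G x1 alpha theta gamma z t.-1).

Definition sgd_params (R : realType) (T : nat) (eta : R)
    (alpha theta gamma : nat -> R) : Prop :=
  forall t, (1 <= t <= T)%N ->
    [/\ 0 < alpha t <= 1, theta t = eta & gamma t = eta].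

Definition rsag_params (R : realType) (T : nat) (eta : R)
    (alpha theta gamma : nat -> R) : Prop :=
  forall t, (1 <= t <= T)%N ->
    [/\ alpha t = 2 / (t%:R + 1), theta t = eta
      & gamma t = (1 + alpha t) * theta t].

(* Main.v *)
Require Import Defs.
From HB Require Import structures.
From mathcomp Require Import all_boot all_order all_algebra finmap.
From mathcomp Require Import all_classical all_reals all_analysis.
From mathcomp Require Import measurable_realfun ring lra.
Import Order.TTheory GRing.Theory Num.Theory.
Import numFieldNormedType.Exports.
Local Open Scope classical_set_scope.
Local Open Scope ring_scope.

Set Implicit Arguments.
Unset Strict Implicit.

(** The iterate [x_t] is an inexact gradient descent evaluated at [xbar_t].  As
long as [f x_t - f^*] stays below a fixed fraction of [Deltac], the step size
forces [|xbar_t - x_t| <= 1 / (8 L1)], so that the smoothness coefficient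
[L0 + L1 |grad f|] is at most [H = L0 + L1 Mc] along the trajectory.  The
descent inequality at [x_t] then reads
  [f x_(t+1) <= f x_t - eta <grad f xbar_t, g_t> + H eta^2 |g_t|^2
                + H / 2 |xbar_t - x_t|^2],
and the terms [H / 2 |xbar_t - x_t|^2] sum to at most [eta^2 H sum |g_t|^2].
The martingale term
[- sum <grad f xbar_t, g_t - grad f xbar_t>] is controlled by Hoeffding's lemma
applied conditionally to each summand, truncated on [f xbar_t - f^* <= Deltac]:
with [mu = 1 / (3 b2)], [b2] bounding the squared noise, the exponential of
[sum (- mu <grad f xbar_t, noise_t> - mu / 4 |grad f xbar_t|^2)] has expectation
at most 1, hence each of the [T] partial sums exceeds [ln (T / delta)] with
probability at most [delta / T].  Outside these events the energy inequality
keeps [f x_(t+1) - f^*] below the same fraction of [Deltac], which closes the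
induction, and at time [T] it bounds the average squared gradient. *)

(** * Euclidean geometry and smoothness *)

Definition dot (R : realType) (d : nat) (u v : 'rV[R]_d) : R :=
  \sum_(i < d) u 0 i * v 0 i.

Section euclidean.
Context {R : realType} {d : nat}.
Implicit Types (u v w : 'rV[R]_d) (k : R).

Lemma dotC u v : dot u v = dot v u.
Proof. by apply: eq_bigr => i _; rewrite mulrC. Qed.

Lemma dotDl u v w : dot (u + v) w = dot u w + dot v w.
Proof. by rewrite -big_split; apply: eq_bigr => i _; rewrite !mxE mulrDl. Qed.

Lemma dotZl k u w : dot (k *: u) w = k * dot u w.
Proof. by rewrite mulr_sumr; apply: eq_bigr => i _; rewrite !mxE mulrA. Qed.

Lemma dotDr u v w : dot u (v + w) = dot u v + dot u w.
Proof. by rewrite dotC dotDl !(dotC _ u). Qed.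

Lemma dotZr k u w : dot u (k *: w) = k * dot u w.
Proof. by rewrite dotC dotZl dotC. Qed.

Lemma dotNl u w : dot (- u) w = - dot u w.
Proof. by rewrite -scaleN1r dotZl mulN1r. Qed.

Lemma dotNr u w : dot u (- w) = - dot u w.
Proof. by rewrite dotC dotNl dotC. Qed.

Lemma dot_ge0 u : 0 <= dot u u.
Proof. by apply: sumr_ge0 => i _; rewrite -expr2 sqr_ge0. Qed.

Lemma enorm_ge0 u : 0 <= enorm u.
Proof. exact: sqrtr_ge0. Qed.

Lemma enorm_sqr u : enorm u ^+ 2 = dot u u.
Proof.
rewrite sqr_sqrtr; first by apply: eq_bigr => i _; rewrite expr2.
by apply: sumr_ge0 => i _; rewrite sqr_ge0.
Qed.

Lemma enormZ k u : enorm (k *: u) = `|k| * enorm u.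
Proof.
apply/eqP; rewrite -(@eqrXn2 _ 2)// ?mulr_ge0 ?enorm_ge0//.
by rewrite exprMn !enorm_sqr dotZl dotZr mulrA real_normK ?num_real.
Qed.

Lemma enormN u : enorm (- u) = enorm u.
Proof. by rewrite -scaleN1r enormZ normrN1 mul1r. Qed.

Lemma enorm0 : enorm (0 : 'rV[R]_d) = 0.
Proof. by rewrite -(scale0r 0) enormZ normr0 mul0r. Qed.

Lemma enorm0_dot u v : enorm v = 0 -> dot u v = 0.
Proof.
move=> v0; have /psumr_eq0P h : dot v v = 0 by rewrite -enorm_sqr v0 expr0n.
apply: big1 => i _.
have /eqP := h (fun j _ => sqr_ge0 (v 0 j)) i isT.
by rewrite mulf_eq0 orbb => /eqP ->; rewrite mulr0.
Qed.

Lemma CauchySchwarz u v : dot u v <= enorm u * enorm v.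
Proof.
have [u0|uN0] := eqVneq (enorm u) 0.
  by rewrite dotC enorm0_dot// u0 mul0r.
have [v0|vN0] := eqVneq (enorm v) 0.
  by rewrite enorm0_dot// v0 mulr0.
have u_gt0 : 0 < enorm u by rewrite lt_neqAle eq_sym uN0 enorm_ge0.
have v_gt0 : 0 < enorm v by rewrite lt_neqAle eq_sym vN0 enorm_ge0.
have := dot_ge0 (enorm v *: u - enorm u *: v).
rewrite !(dotDl, dotDr, dotNl, dotNr, dotZl, dotZr) -!enorm_sqr (dotC v u) => h.
by rewrite -(ler_pM2l (mulr_gt0 u_gt0 v_gt0)); move: h; lra.
Qed.

Lemma dot_norm_le u v : `|dot u v| <= enorm u * enorm v.
Proof.
rewrite ler_norml CauchySchwarz andbT lerNl -dotNl.
by rewrite (le_trans (CauchySchwarz _ _))// enormN.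
Qed.

Lemma enormD u v : enorm (u + v) <= enorm u + enorm v.
Proof.
rewrite -(@ler_pXn2r _ 2)// ?nnegrE ?addr_ge0 ?enorm_ge0//.
rewrite sqrrD !enorm_sqr !(dotDl, dotDr) (dotC v u).
have := CauchySchwarz u v; lra.
Qed.

Lemma enormB u v : enorm (u - v) <= enorm u + enorm v.
Proof. by rewrite -(enormN v) enormD. Qed.

Lemma enormBC u v : enorm (u - v) = enorm (v - u).
Proof. by rewrite -enormN opprB. Qed.

Lemma enormD_sqr u v : enorm (u + v) ^+ 2 <= 2 * enorm u ^+ 2 + 2 * enorm v ^+ 2.
Proof.
rewrite !enorm_sqr; have := dot_ge0 (u - v).
rewrite !(dotDl, dotDr, dotNl, dotNr) (dotC v u); lra.
Qed.

Lemma enorm_conv_sqr k u v : 0 <= k <= 1 ->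
  enorm ((1 - k) *: u + k *: v) ^+ 2 <= (1 - k) * enorm u ^+ 2 + k * enorm v ^+ 2.
Proof.
move=> /andP[k0 k1]; rewrite !enorm_sqr.
have := mulr_ge0 (mulr_ge0 k0 (_ : 0 <= 1 - k)) (dot_ge0 (u - v)).
rewrite subr_ge0 => /(_ k1).
rewrite !(dotDl, dotDr, dotNl, dotNr, dotZl, dotZr) (dotC v u); lra.
Qed.

End euclidean.

(** * Smoothness: descent along segments, gradients controlled by the gap to the infimum *)

Section smoothness.
Context {R : realType} {d : nat} (f : 'rV[R]_d -> R).
Hypothesis df : forall x : 'rV[R]_d, differentiable f x.

Lemma derive_grad (x v : 'rV[R]_d) : 'D_v f x = dot (grad f x) v.
Proof.
rewrite deriveE//.
rewrite [in LHS](row_sum_delta v) linear_sum/=; apply: eq_bigr => i _.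
by rewrite linearZ/= mxE deriveE// mulrC.
Qed.

Lemma is_derive_line (x v : 'rV[R]_d) (s : R) :
  is_derive s 1 (fun r => f (x + r *: v)) (dot (grad f (x + s *: v)) v).
Proof.
(* The difference quotient of [f] at [x + s *: v] in direction [v]; it is the same function of [h]
   as the quotient of the restriction to the line. *)
pose q (h : R) : R := h^-1 *: (f (h *: v + (x + s *: v)) - f (x + s *: v)).
have qE : (fun h : R => h^-1 *: (((fun r => f (x + r *: v)) \o shift s) (h *: 1)
    - f (x + s *: v))) = q.
  apply/funext => h; rewrite /q /= [h *: 1]mulr1 scalerDl.
  by congr (_ *: (f _ - _)); rewrite addrCA.
apply: DeriveDef; rewrite /derivable /derive qE.
  exact: (@diff_derivable _ _ _ f (x + s *: v) v).
exact: derive_grad.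
Qed.

Context (L0 L1 : R) (L0_gt0 : 0 < L0) (L1_gt0 : 0 < L1).
Hypothesis smooth : L0L1_smooth L0 L1 f.

(** [psi] is [f] on the segment minus its quadratic model. Smoothness is used with base point [x],
    so that the coefficient [K] is frozen along the segment; then [psi] has nonpositive derivative
    on [0, 1]. *)
Lemma descent (x v : 'rV[R]_d) : enorm v <= 1 / L1 ->
  f (x + v) <= f x + dot (grad f x) v
    + (L0 + L1 * enorm (grad f x)) / 2 * enorm v ^+ 2.
Proof.
move=> vL; set K := L0 + _.
pose psi (s : R) := f (x + s *: v) - (s * dot (grad f x) v + K / 2 * enorm v ^+ 2 * s ^+ 2).
have dpsi (s : R) : is_derive s 1 psi
    (dot (grad f (x + s *: v)) v - (dot (grad f x) v + K * enorm v ^+ 2 * s)).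
  have hi := is_derive_id s (1 : R).
  have hp := is_deriveB (is_derive_line x v s) (is_deriveD
    (is_deriveZ (dot (grad f x) v) hi) (is_deriveZ (K / 2 * enorm v ^+ 2) (is_deriveX 2 hi))).
  have -> : psi = f \o (fun r => x + r *: v) -
      (dot (grad f x) v \*: @id R + (K / 2 * enorm v ^+ 2) \*: (@id R) ^+ 2).
    by apply/funext => r; rewrite /psi !fctE /GRing.scale/= mulrC.
  apply: (is_derive_eq hp).
  by rewrite /GRing.scale/=; lra.
suff : psi 1 <= psi 0.
  rewrite /psi !scale0r !scale1r addr0 expr1n expr0n/=; lra.
apply: (@ler0_derive1_le_cc R psi 0 1); rewrite ?in_itv/= ?lexx ?ler01//.
- move=> s; rewrite in_itv/= => /andP[s0 s1].
  rewrite derive1E; have [_ ->] := dpsi s.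
  have h : dot (grad f (x + s *: v) - grad f x) v <= K * enorm v ^+ 2 * s.
    rewrite (le_trans (CauchySchwarz _ _))//.
    have -> : K * enorm v ^+ 2 * s = K * (s * enorm v) * enorm v by ring.
    rewrite ler_wpM2r ?enorm_ge0// enormBC.
    have e : enorm (x - (x + s *: v)) = s * enorm v.
      by rewrite opprD addNKr enormN enormZ gtr0_norm.
    rewrite -e; apply: smooth; rewrite e.
    rewrite (le_trans _ vL)// ler_piMl ?enorm_ge0// ltW//.
  by move: h; rewrite dotDl dotNl; lra.
- apply: continuous_subspaceT => s.
  by apply: differentiable_continuous; apply/derivable1_diffP; case: (dpsi s).
Qed.

Context (m : R) (f_ge : forall x : 'rV[R]_d, m <= f x).

(** A gradient step of length [g / (L0 + L1 g)] is shorter than [1 / L1], so descent applies and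
    cannot go below [m]: [g^2 <= 2 (L0 + L1 g) D]. The product [L1 g D] is then absorbed by
    [(g - 2 L1 D)^2 >= 0]. *)
Lemma grad_sqr_le_gap (x : 'rV[R]_d) : enorm (grad f x) ^+ 2 <=
  4 * (L0 * (f x - m) + L1 ^+ 2 * (f x - m) ^+ 2).
Proof.
set g := enorm (grad f x); set D := f x - m.
have g0 : 0 <= g by exact: enorm_ge0.
have K0 : 0 < L0 + L1 * g by rewrite ltr_wpDr// mulr_ge0// ltW.
have D0 : 0 <= D by rewrite subr_ge0.
have step : g ^+ 2 <= 2 * (L0 + L1 * g) * D.
  have := @descent x (- (L0 + L1 * g)^-1 *: grad f x).
  rewrite enormZ normrN gtr0_norm ?invr_gt0// dotZr -enorm_sqr -/g.
  have -> : (L0 + L1 * g)^-1 * g <= 1 / L1.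
    by rewrite ler_pdivlMr// -mulrA ler_pdivrMl// mulr1 (mulrC g) lerDr ltW.
  move=> /(_ isT) h; have {h} := le_trans (f_ge _) h.
  set K := L0 + _ in K0 *.
  have -> : f x + - K^-1 * g ^+ 2 + K / 2 * (K^-1 * g) ^+ 2 = f x - (g ^+ 2 / (2 * K)).
    by field; rewrite gt_eqF.
  rewrite lerBrDl -lerBrDr -/D ler_pdivrMr; last by rewrite mulr_gt0.
  by rewrite (mulrC D).
have := sqr_ge0 (g - 2 * L1 * D).
lra.
Qed.

End smoothness.

(** * Hoeffding's lemma *)

Section hoeffding.
Context {R : realType}.
Implicit Types (x y a : R).

(* [expR r <= (1 - r)^-1], used through [expR x = expR (x / 3) ^+ 3]: the cube
   makes the quadratic coefficient 2/3, which leaves room below 3/4. *)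
Lemma cosh_le_small x : `|x| <= 1 / 2 ->
  (expR x + expR (- x)) / 2 <= expR (3 / 4 * x ^+ 2).
Proof.
rewrite ler_norml => /andP[x1 x2]; set y := x / 3.
have expR3 (r : R) : r < 1 -> expR (3 * r) <= ((1 - r)^-1) ^+ 3.
  move=> r1; have r0 : 0 <= 1 - r by lra.
  rewrite expRM_natl lerXn2r ?nnegrE ?expR_ge0 ?invr_ge0//.
  rewrite -[expR r]invrK lef_pV2 ?posrE ?invr_gt0 ?expR_gt0 ?subr_gt0// -expRN.
  by rewrite expR_ge1Dx.
have -> : x = 3 * y by rewrite /y; lra.
have h1 : expR (3 * y) <= ((1 - y)^-1) ^+ 3 by apply: expR3; rewrite /y; lra.
have h2 : expR (- (3 * y)) <= ((1 + y)^-1) ^+ 3.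
  by rewrite -mulrN -{2}[y]opprK; apply: expR3; rewrite /y; lra.
have h3 : 1 + 27 / 4 * y ^+ 2 <= expR (3 / 4 * (3 * y) ^+ 2).
  by apply: le_trans (expR_ge1Dx _); lra.
apply: le_trans h3.
have p1 : 0 < 1 - y by rewrite /y; lra.
have p2 : 0 < 1 + y by rewrite /y; lra.
have p3 : 0 < 1 - y ^+ 2.
  have := mulr_gt0 p1 p2; lra.
have h4 : ((1 - y)^-1) ^+ 3 + ((1 + y)^-1) ^+ 3 <= 2 * (1 + 27 / 4 * y ^+ 2).
  have -> : ((1 - y)^-1) ^+ 3 + ((1 + y)^-1) ^+ 3 =
      (2 + 6 * y ^+ 2) / ((1 - y ^+ 2) ^+ 3).
    field.
    by rewrite (gt_eqF p1) (gt_eqF p2) gt_eqF.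
  rewrite ler_pdivrMr ?exprn_gt0//.
  have : 0 <= (1 / 6 - y) * (1 / 6 + y) by apply: mulr_ge0; rewrite /y; lra.
  have := sqr_ge0 y.
  set v := y ^+ 2 => v0 v1.
  have {}v1 : v <= 1 / 36 by move: v1; rewrite /v; lra.
  have v2 : 0 <= 1 / 36 - v by lra.
  have v3 : 0 <= 1 - v by lra.
  have := mulr_ge0 v0 v2; have := mulr_ge0 (exprn_ge0 3 v0) v3.
  have := exprn_ge0 3 v0; lra.
lra.
Qed.

(* The bound is stable under [x -> 2 x], as [cosh (2 x) = 2 cosh x ^ 2 - 1] and
   [2 E ^ 2 - 1 <= E ^ 4]. *)
Lemma cosh_le x : (expR x + expR (- x)) / 2 <= expR (3 / 4 * x ^+ 2).
Proof.
have double y : (expR y + expR (- y)) / 2 <= expR (3 / 4 * y ^+ 2) ->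
    (expR (2 * y) + expR (- (2 * y))) / 2 <= expR (3 / 4 * (2 * y) ^+ 2).
  have -> : 3 / 4 * (2 * y) ^+ 2 = 2 * (2 * (3 / 4 * y ^+ 2)) by ring.
  rewrite -mulrN !expRM_natl; set E := expR (3 / 4 * _) => h.
  have -> : expR y ^+ 2 + expR (- y) ^+ 2 = (expR y + expR (- y)) ^+ 2 - 2.
    by rewrite sqrrD -mulrnAr -mulr_natl mulrCA -expRD subrr expR0; lra.
  have h0 : 0 <= (expR y + expR (- y)) / 2.
    by rewrite divr_ge0// addr_ge0// expR_ge0.
  have : ((expR y + expR (- y)) / 2) ^+ 2 <= E ^+ 2.
    by rewrite lerXn2r ?nnegrE// expR_ge0.
  have := sqr_ge0 (E ^+ 2 - 1); lra.
have [n xn] : exists n : nat, `|x| <= 2 ^+ n / 2.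
  exists (Num.bound (2 * `|x|)); rewrite ler_pdivlMr// mulrC.
  apply/ltW/(lt_le_trans (archi_boundP _)); first by rewrite mulr_ge0.
  by rewrite -natrX ler_nat ltnW// ltn_expl.
elim: n x xn => [|n IHn] x xn; first by apply: cosh_le_small; rewrite expr0 in xn.
have -> : x = 2 * (x / 2) by lra.
apply: double; apply: IHn; rewrite normrM (gtr0_norm (_ : 0 < 2^-1))//.
by rewrite ler_pdivrMr//; move: xn; rewrite exprS; lra.
Qed.

(** By convexity [expR] lies below its chord on [-a, a], whose value at 0 is [cosh a]. Convexity
    comes from the tangent at [y] evaluated at [a] and [- a]: with weights [a + y] and [a - y] the
    slopes cancel. *)
Lemma expR_le_affine a : 0 <= a -> exists k, forall y, `|y| <= a ->
  expR y <= expR (3 / 4 * a ^+ 2) + k * y.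
Proof.
rewrite le_eqVlt => /predU1P[<-|a0].
  exists 0 => y; rewrite normr_le0 => /eqP ->.
  by rewrite expr0n/= !mulr0 addr0.
exists ((expR a - expR (- a)) / (2 * a)) => y; rewrite ler_norml => /andP[y1 y2].
apply: (@le_trans _ _ ((expR a + expR (- a)) / 2 + (expR a - expR (- a)) / (2 * a) * y));
  last by rewrite lerD2r cosh_le.
have h1 : expR y * (1 + (a - y)) <= expR a.
  by rewrite -[in leRHS](subrKC y a) expRD ler_wpM2l ?expR_ge0 ?expR_ge1Dx.
have h2 : expR y * (1 + (- a - y)) <= expR (- a).
  by rewrite -[in leRHS](subrKC y (- a)) expRD ler_wpM2l ?expR_ge0 ?expR_ge1Dx.
have e1 := ler_wpM2l (_ : 0 <= a + y) h1.
have e2 := ler_wpM2l (_ : 0 <= a - y) h2.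
rewrite -(ler_pM2l (_ : 0 < 2 * a)) ?mulr_gt0//.
have -> : 2 * a * ((expR a + expR (- a)) / 2 + (expR a - expR (- a)) / (2 * a) * y) =
  (a + y) * expR a + (a - y) * expR (- a) by field; rewrite gt_eqF.
have {}e1 := e1 ltac:(lra); have {}e2 := e2 ltac:(lra).
lra.
Qed.

(** Integrating the affine bound [u] kills its linear term, the mean being zero. *)
Lemma hoeffding_lemma d (T : measurableType d) (P : probability T R) (X : T -> R) a :
  0 <= a -> P.-integrable setT (EFin \o X) -> (\int[P]_w (X w)%:E = 0)%E ->
  {ae P, forall w, `|X w| <= a} ->
  (\int[P]_w (expR (X w))%:E <= (expR (3 / 4 * a ^+ 2))%:E)%E.
Proof.
move=> a0 iX X0 Xa; have [k hk] := expR_le_affine a0.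
have mX : measurable_fun setT X by apply/measurable_EFinP; case/integrableP: iX.
set c := expR (3 / 4 * a ^+ 2) in hk *.
pose u w := c + k * X w.
have mu : measurable_fun setT u.
  by apply: measurable_funD => //; apply: measurable_funM.
have ule : {ae P, forall w, expR (X w) <= u w}.
  by apply: filterS Xa => w /hk.
(* The bound [u] is nonnegative only almost everywhere, hence the detour through its absolute
   value. *)
apply: (@le_trans _ _ (\int[P]_w `|(u w)%:E|)%E).
  apply: ae_ge0_le_integral => //.
  - by apply/measurable_EFinP; exact: measurableT_comp.
  - by apply: measurableT_comp => //; exact/measurable_EFinP.
  - by apply: filterS ule => w ux _; rewrite /= lee_fin (le_trans ux)// ler_norm.
have -> : (\int[P]_w `|(u w)%:E| = \int[P]_w (u w)%:E)%E.
  apply: ae_eq_integral => //.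
  - by apply: measurableT_comp => //; exact/measurable_EFinP.
  - exact/measurable_EFinP.
  - apply: filterS ule => w ux _; rewrite /= ger0_norm//.
    by rewrite (le_trans _ ux)// expR_ge0.
under eq_integral do rewrite /u EFinD EFinM.
rewrite integralD//=; last 2 first.
- exact: finite_measure_integrable_cst.
- exact: integrableZl.
rewrite integral_cst// integralZl// X0 mule0 adde0.
by rewrite [leLHS](_ : _ = c%:E)// -[RHS]mule1; congr (_ * _)%E; exact: probability_setT.
Qed.

End hoeffding.

(** * Measurability of random gradients *)

Section caratheodory.
Context {R : realType} {n : nat} {dY dZ : measure_display}.
Context {Y : measurableType dY} {Z : measurableType dZ}.

Lemma measurable_countable_select (K : countType) (q : Y -> K) (G : K -> Y -> R) :
  (forall k, measurable (q @^-1` [set k])) -> (forall k, measurable_fun setT (G k)) ->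
  measurable_fun setT (fun y => G (q y) y).
Proof.
move=> mq mG _ B mB; rewrite setTI.
have -> : (fun y => G (q y) y) @^-1` B =
    \bigcup_k (q @^-1` [set k] `&` G k @^-1` B).
  apply/seteqP; split => y /=; first by move=> By; exists (q y).
  by move=> [k _ [/= <-]].
apply: countable_bigcupT_measurable => [|k]; first exact: countableP.
apply: measurableI => //; rewrite -[X in measurable X]setTI; exact: mG.
Qed.

(** The cell of side [1 / (m + 1)] containing [x] is recorded by integers, so that the index ranges
    over a countable type; [of_grid] returns the lower corner of the cell. *)
Definition grid (m : nat) (x : 'rV[R]_n) : 'rV[int]_n :=
  \row_i Num.floor (m.+1%:R * x 0 i).

Definition of_grid (m : nat) (k : 'rV[int]_n) : 'rV[R]_n :=
  \row_i ((k 0 i)%:~R / m.+1%:R).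

Lemma cvg_grid (x : 'rV[R]_n) : of_grid m (grid m x) @[m --> \oo] --> x.
Proof.
apply/cvg_ballP => e e0.
have /cvgrPdist_lt/(_ e e0) := @cvg_harmonic R.
apply: filterS => m /=; rewrite sub0r normrN => he; split => // i j.
rewrite /ball/= !mxE !ord1; set N := m.+1%:R.
have N0 : 0 < N :> R by rewrite ltr0n.
have /andP[h1 h2] := floor_itv (N * x 0 j).
rewrite ger0_norm ?subr_ge0; last by rewrite ler_pdivrMr// (mulrC (x 0 j)).
rewrite (le_lt_trans _ he)//= normfV ger0_norm ?ler0n// -/N.
rewrite lerBlDl -(ler_pM2l N0) mulrDr divff ?gt_eqF// mulrCA divff ?gt_eqF// mulr1.
by rewrite ltW// -[X in _ < _ + X](mulr1z 1) -intrD.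
Qed.

(* Approximating [X] by points of the grid [Z^n / (m + 1)] reduces joint
   measurability to countably many measurable pieces. *)
Lemma measurable_caratheodory (F : 'rV[R]_n -> Z -> R) (X : Y -> 'rV[R]_n) (h : Y -> Z) :
  (forall x, measurable_fun setT (F x)) -> (forall z, continuous (F ^~ z)) ->
  measurable_fun setT h -> (forall i, measurable_fun setT (fun y => X y 0 i)) ->
  measurable_fun setT (fun y => F (X y) (h y)).
Proof.
move=> mF cF mh mX.
apply: (@measurable_fun_cvg _ _ _ _ (fun m y => F (of_grid m (grid m (X y))) (h y))).
  move=> m; apply: (@measurable_countable_select _ (fun y => grid m (X y))
    (fun k y => F (of_grid m k) (h y))) => [k|k]; last exact: measurableT_comp.
  have -> : (fun y => grid m (X y)) @^-1` [set k] = \bigcap_(i in [set: 'I_n])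
      ((fun y => X y 0 i) @^-1` [set a | (k 0 i)%:~R <= m.+1%:R * a < (k 0 i + 1)%:~R]).
    apply/seteqP; split => y /=.
      move=> <- i _ /=.
      by rewrite mxE floor_itv.
    move=> H; apply/rowP => i; rewrite mxE.
    by apply: floor_def; exact: H.
  apply: fin_bigcap_measurable => [|i _]; first exact: finite_finset.
  rewrite -[X in measurable X]setTI.
  apply: mX => //.
  have -> : [set a : R | (k 0 i)%:~R <= m.+1%:R * a < (k 0 i + 1)%:~R] =
      `[(k 0 i)%:~R / m.+1%:R, (k 0 i + 1)%:~R / m.+1%:R[%classic.
    by apply/seteqP; split => a /=; rewrite in_itv/= ler_pdivrMr// ltr_pdivlMr// mulrC.
  exact: measurable_itv.
move=> y _; apply: (@cvg_comp _ _ _ (fun m => of_grid m (grid m (X y))) (F ^~ (h y))).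
  exact: cvg_grid.
exact: cF.
Qed.

(** A partial derivative is the limit of difference quotients along the steps [1 / (m + 1)], each of
    them measurable by the Caratheodory argument. *)
Lemma measurable_grad (F : 'rV[R]_n -> Z -> R) (X : Y -> 'rV[R]_n) (h : Y -> Z) :
  (forall x, measurable_fun setT (F x)) -> (forall z x, differentiable (F ^~ z) x) ->
  measurable_fun setT h -> (forall i, measurable_fun setT (fun y => X y 0 i)) ->
  forall i, measurable_fun setT (fun y => grad (F ^~ (h y)) (X y) 0 i).
Proof.
move=> mF dF mh mX i.
have cF z : continuous (F ^~ z) by move=> x; exact: differentiable_continuous.
pose e m : R := m.+1%:R^-1.
apply: (@measurable_fun_cvg _ _ _ _ (fun m y =>
  (e m)^-1 * (F (e m *: delta_mx 0 i + X y) (h y) - F (X y) (h y)))).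
  move=> m; apply: measurable_funM => //; apply: measurable_funB.
    apply: (@measurable_caratheodory F (fun y => e m *: delta_mx 0 i + X y)) => // j.
    by under eq_fun do rewrite mxE; apply: measurable_funD.
  exact: measurable_caratheodory.
move=> y _; rewrite mxE.
have := @diff_derivable _ _ _ (F ^~ (h y)) (X y) (delta_mx 0 i) (dF _ _).
move/cvgr_dnbhsP/(_ e); apply; split; last exact: cvg_harmonic.
by move=> m; rewrite invr_eq0 pnatr_eq0.
Qed.

End caratheodory.

Lemma measurable_row_fun {R : realType} {n : nat} {dY} {Y : measurableType dY}
    (f : 'rV[R]_n -> R) (X : Y -> 'rV[R]_n) :
  (forall x, differentiable f x) -> (forall i, measurable_fun setT (fun y => X y 0 i)) ->
  measurable_fun setT (fun y => f (X y)).
Proof.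
move=> df mX; apply: (@measurable_caratheodory _ _ _ _ Y Y (fun x _ => f x) X id) => //.
by move=> _ x; exact: differentiable_continuous.
Qed.

Lemma measurable_row_grad {R : realType} {n : nat} {dY} {Y : measurableType dY}
    (f : 'rV[R]_n -> R) (X : Y -> 'rV[R]_n) :
  (forall x, differentiable f x) -> (forall i, measurable_fun setT (fun y => X y 0 i)) ->
  forall i, measurable_fun setT (fun y => grad f (X y) 0 i).
Proof.
by move=> df mX i; apply: (@measurable_grad _ _ _ _ Y Y (fun x _ => f x) X id).
Qed.

(** * Integration against an independent sample *)

Section independence.
Local Open Scope ereal_scope.
Context {R : realType} {dO dZ : measure_display}.
Context {Omega : measurableType dO} {Z : measurableType dZ}.
Context (P : probability Omega R) (D : probability Z R).

Section freezing.
Context (G : set (set Omega)) (V : {RV P >-> Z}).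
Hypotheses (mG : G `<=` measurable) (GI : setI_closed G) (GT : G setT).
Hypothesis indep : forall A B, G A -> measurable B ->
  P (A `&` V @^-1` B) = P A * D B.

Let OG := g_sigma_algebraType G.

Lemma measurable_sub_sigma (A : set Omega) : <<s G >> A -> measurable A.
Proof. by apply: smallest_sub => //; exact: sigma_algebra_measurable. Qed.

(** For fixed [B], both sides are finite measures in [A] that agree on the pi-system [G], hence on
    the sigma-algebra it generates. *)
Lemma indep_sigma (A : set Omega) (B : set Z) : <<s G >> A -> measurable B ->
  P (A `&` V @^-1` B) = P A * D B.
Proof.
move=> sA mB.
have mV : measurable (V @^-1` B) by rewrite -[X in measurable X]setTI; exact: measurable_funP.
have DB0 : (0 <= fine (D B))%R by rewrite fine_ge0.
pose r : {nonneg R} := NngNum DB0.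
have DBE : D B = (fine (D B))%:E by rewrite fineK// fin_num_measure.
have rE C : mscale r P C = P C * D B by rewrite muleC DBE.
rewrite -rE; apply: (@g_sigma_algebra_measure_unique _ R Omega G mG (fun=> setT) (fun=> GT) _
  (mrestr P mV) (mscale r P) GI) => //.
- by rewrite bigcup_const.
- by move=> C GC; apply: etrans (esym (rE C)); exact: indep.
- move=> _; apply: (@le_lt_trans _ _ (P setT * D B)); first by rewrite -indep.
  rewrite -ge0_fin_numE ?mule_ge0//.
  by rewrite fin_numM ?fin_num_measure.
Qed.

Lemma measurable_id_sub : measurable_fun [set: Omega] (id : Omega -> OG).
Proof. by move=> _ A mA; rewrite setTI; exact: measurable_sub_sigma. Qed.

(** The law of this map is [P] restricted to the sigma-algebra generated by [G]. *)
Let idG : {mfun Omega >-> OG} := HB.pack (id : Omega -> OG)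
  (isMeasurableFun.Build _ _ _ _ _ measurable_id_sub).

Lemma measurable_graph : measurable_fun [set: Omega] (fun w => ((w : OG), V w)).
Proof. by apply: measurable_fun_pair; [exact: measurable_id_sub|exact: measurable_funP]. Qed.

Let graph : {mfun Omega >-> (OG * Z)%type} := HB.pack (fun w : Omega => ((w : OG), V w))
  (isMeasurableFun.Build _ _ _ _ _ measurable_graph).

(* Conditional expectation given [G] is expressed as an integral over
   [g_sigma_algebraType G * Z]: the law of [w |-> (w, V w)] is a product measure. *)
Lemma integral_freezing (H : OG * Z -> \bar R) : measurable_fun setT H ->
  (forall x, 0 <= H x) ->
  \int[P]_w H (w, V w) = \int[P]_w \int[D]_z H (w, z).
Proof.
move=> mH H0.
pose PG : probability OG R := distribution P idG.
pose Q : probability (OG * Z)%type R := distribution P graph.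
have QE (S : set (OG * Z)) : measurable S -> (PG \x D) S = Q S.
  apply: product_measure_unique => A B mA mB.
  exact: indep_sigma.
have -> : \int[P]_w H (w, V w) = \int[Q]_x H x.
  by rewrite ge0_integral_distribution.
have -> : \int[Q]_x H x = \int[PG \x D]_x H x.
  by apply: eq_measure_integral => A mA _; apply/esym; exact: QE.
rewrite fubini_tonelli1// ge0_integral_distribution//.
- exact: measurable_fun_fubini_tonelli_F.
- by move=> x; apply: integral_ge0.
Qed.

End freezing.

(** Rectangles in the first [n] samples: a pi-system generating their history, on which
    [mutually_independent] can be applied directly. *)
Definition past (X : nat -> {RV P >-> Z}) (n : nat) : set (set Omega) :=
  [set A | exists2 E : nat -> set Z, (forall j, measurable (E j)) &
    A = \bigcap_(j in [set j | (1 <= j <= n)%N]) X j @^-1` E j].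

Context (X : nat -> {RV P >-> Z}).

Lemma past_measurable n : past X n `<=` measurable.
Proof.
move=> _ [E mE ->]; apply: fin_bigcap_measurable => [|j _]; last first.
  by rewrite -[A in measurable A]setTI; exact: measurable_funP.
apply: (@sub_finite_set _ _ `I_n.+1); last exact: finite_II.
by move=> j /= /andP[].
Qed.

Lemma past_setI n : setI_closed (past X n).
Proof.
move=> _ _ [E mE ->] [E' mE' ->]; exists (fun j => E j `&` E' j).
  by move=> j; exact: measurableI.
by rewrite -bigcapI.
Qed.

Lemma past_setT n : past X n setT.
Proof.
exists (fun=> setT) => //; apply/esym; rewrite -subTset => w _ j _.
exact: I.
Qed.

Lemma measurable_past n j : (1 <= j <= n)%N ->
  measurable_fun [set: g_sigma_algebraType (past X n)] (X j : Omega -> Z).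
Proof.
move=> jn _ B mB; rewrite setTI; apply: sub_sigma_algebra.
exists (fun i => if i == j then B else setT) => [i|]; first by case: ifP.
apply/seteqP; split => w /=.
  by move=> Bw i _ /=; case: eqP => [->|].
by move=> /(_ j jn); rewrite /= eqxx.
Qed.

(** Intersecting with the event on sample [n + 1] gives a rectangle over one more index. The product
    rule is applied to it and to the original one, and the factors are compared. *)
Lemma past_indep T n A B : iid_samples D T X -> (n < T)%N -> past X n A ->
  measurable B -> P (A `&` X n.+1 @^-1` B) = P A * D B.
Proof.
move=> [ind law] nT [E mE ->] mB.
pose E' j := if j == n.+1 then B else E j.
pose J := [fset j in iota 1 n]%fset.
have inJ j : (j \in J) = (1 <= j <= n)%N by rewrite !inE mem_iota add1n ltnS.
have JE j : j \in J -> E' j = E j.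
  by rewrite inJ /E' => /andP[_ jn]; rewrite ltn_eqF.
have SJ : [set j | (1 <= j <= n)%N] = [set` J].
  by apply/seteqP; split => j /=; rewrite inJ.
have nJ : n.+1 \notin J by rewrite inJ ltnn andbF.
have mE' j : measurable (E' j) by rewrite /E'; case: ifP.
have E'n : E' n.+1 = B by rewrite /E' eqxx.
have -> : \bigcap_(j in [set j | (1 <= j <= n)%N]) X j @^-1` E j =
    \bigcap_(j in [set` J]) X j @^-1` E' j.
  by rewrite SJ; apply: eq_bigcapr => j /= /JE ->.
have := ind (n.+1 |` J)%fset E'.
rewrite big_fsetU1//= set_fsetU1 bigcap_setU1 E'n setIC => ->; last 2 first.
- by move=> j /= [->//|]; rewrite /= inJ => /andP[-> jn]; exact: leq_trans jn (ltnW nT).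
- by [].
rewrite (ind J E')//; last first.
  by move=> j /=; rewrite inJ => /andP[-> jn]; exact: leq_trans jn (ltnW nT).
rewrite muleC; congr (_ * _); exact: law.
Qed.

Lemma integral_past T n (H : g_sigma_algebraType (past X n) * Z -> \bar R) :
  iid_samples D T X -> (n < T)%N -> measurable_fun setT H -> (forall x, 0 <= H x) ->
  \int[P]_w H (w, X n.+1 w) = \int[P]_w \int[D]_z H (w, z).
Proof.
move=> iid nT mH H0; apply: integral_freezing => //.
- exact: past_measurable.
- exact: past_setI.
- exact: past_setT.
- by move=> A B; exact: past_indep iid nT.
Qed.

End independence.

(** * Deterministic descent analysis *)

(* [D n] is [xtilde_(n+1) - x_(n+1)]; for RSAG it is a weighted average of the
   steps [- eta *: g k], for SGD it vanishes. *)
Section drift.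
Context {R : realType} {d : nat} (T : nat) (eta : R) (eta_ge0 : 0 <= eta).
Context (D g : nat -> 'rV[R]_d) (a b : nat -> R).
Hypothesis D0 : D 0 = 0.
Hypothesis DS : forall n, (n < T)%N -> D n.+1 = (1 - a n) *: D n - (b n * eta) *: g n.
Hypothesis params :
  (forall n, (n < T)%N -> 0 < a n <= 1 /\ b n = 0) \/
  (forall n, (n < T)%N -> a n = 2 / (n%:R + 2) /\ b n = a n).

Lemma drift_weight n : (n < T)%N -> 0 <= a n <= 1.
Proof.
move=> nT; case: params => /(_ n nT) [].
  by move=> /andP[/ltW -> ->].
move=> -> _; rewrite divr_ge0 ?addr_ge0//= ler_pdivrMr; last by rewrite ltr_wpDl.
by rewrite mul1r lerDr.
Qed.

(** As [b n <= a n], the new drift is bounded by a convex combination of [G] with itself. *)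
Lemma drift_le G n : 0 <= G -> (n <= T)%N ->
  (forall k, (k < n)%N -> eta * enorm (g k) <= G) -> enorm (D n) <= G.
Proof.
move=> G0; elim: n => [|n IHn] nT gG; first by rewrite D0 enorm0.
have Dn : enorm (D n) <= G.
  by apply: IHn; [exact: ltnW|move=> k kn; apply: gG; exact: ltnW].
have /andP[a0 a1] := drift_weight nT.
have h : b n * (eta * enorm (g n)) <= a n * G.
  case: params => /(_ n nT) [_ ->]; first by rewrite mul0r mulr_ge0.
  by rewrite ler_wpM2l// gG.
have b0 : 0 <= b n by case: params => /(_ n nT) [_ ->].
rewrite DS// (le_trans (enormB _ _))// !enormZ ger0_norm ?subr_ge0//.
rewrite ger0_norm ?mulr_ge0// -mulrA.
have : (1 - a n) * enorm (D n) <= (1 - a n) * G by rewrite ler_wpM2l// subr_ge0.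
lra.
Qed.

Lemma drift_sum n : (n <= T)%N ->
  \sum_(k < n) enorm ((1 - a k) *: D k) ^+ 2 <=
    2 * eta ^+ 2 * \sum_(k < n) enorm (g k) ^+ 2.
Proof.
move=> nT.
(* For RSAG, [n |D n|^2] is a potential since [a n = 2 / (n + 2)]. *)
suff : \sum_(k < n) enorm ((1 - a k) *: D k) ^+ 2 + n%:R * enorm (D n) ^+ 2 <=
    2 * eta ^+ 2 * \sum_(k < n) enorm (g k) ^+ 2.
  by apply: le_trans; rewrite lerDl mulr_ge0// sqr_ge0.
elim: n nT => [|n IHn] nT; first by rewrite !big_ord0 mul0r !mulr0 addr0.
have {IHn} IH := IHn (ltnW nT).
rewrite !big_ord_recr/= mulrDr.
suff : enorm ((1 - a n) *: D n) ^+ 2 + n.+1%:R * enorm (D n.+1) ^+ 2 <=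
    n%:R * enorm (D n) ^+ 2 + 2 * eta ^+ 2 * enorm (g n) ^+ 2 by lra.
rewrite enormZ exprMn real_normK ?num_real//.
case: params => hp.
  have Dz k : (k <= T)%N -> D k = 0.
    elim: k => [//|k IHk] kT; rewrite DS// IHk; last exact: ltnW.
    by have [_ ->] := hp k kT; rewrite mul0r scale0r scaler0 subr0.
  rewrite (Dz _ nT) (Dz _ (ltnW nT)) enorm0 (_ : (0 : R) ^+ 2 = 0) ?expr0n//.
  by rewrite !mulr0 addr0 add0r; do 2![apply: mulr_ge0; rewrite ?sqr_ge0//].
have /andP[a0 a1] := drift_weight nT.
have [an bn] := hp n nT.
have h : enorm (D n.+1) ^+ 2 <= (1 - a n) * enorm (D n) ^+ 2 + a n * (eta * enorm (g n)) ^+ 2.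
  rewrite DS// bn -scalerA -scalerN.
  apply: le_trans (enorm_conv_sqr _ _ _) _; first by rewrite a0.
  by rewrite enormN enormZ ger0_norm.
have n1 : 0 < n%:R + 1 :> R by rewrite ltr_wpDl.
have n2 : 0 < n%:R + 2 :> R by rewrite ltr_wpDl.
rewrite -natr1.
have {}h := ler_wpM2l (ltW n1) h.
set x := enorm (D n) ^+ 2 in h *; set y := enorm (g n) ^+ 2.
have x0 : 0 <= x by exact: sqr_ge0.
have y0 : 0 <= y by exact: sqr_ge0.
(* The constant 2 arises here: [(n + 1) a n = 2 (n + 1) / (n + 2) <= 2]. *)
have hy : (n%:R + 1) * (a n * (eta * enorm (g n)) ^+ 2) <= 2 * eta ^+ 2 * y.
  rewrite exprMn -/y mulrA -[leRHS]mulrA; apply: ler_wpM2r; first by rewrite mulr_ge0// sqr_ge0.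
  by rewrite an mulrA ler_pdivrMr//; lra.
(* Since [n a n = 2 - 2 a n], the coefficient of [x] on the left equals [n - a n (1 - a n)]. *)
have hx : (1 - a n) ^+ 2 * x + (n%:R + 1) * ((1 - a n) * x) <= n%:R * x.
  rewrite mulrA -mulrDl ler_wpM2r//.
  have -> : (n%:R + 1) * (1 - a n) = n%:R * (1 - a n) + (1 - a n) by ring.
  have na : n%:R * a n = 2 - 2 * a n by rewrite an; field; rewrite gt_eqF.
  have : 0 <= a n * (1 - a n) by rewrite mulr_ge0// subr_ge0.
  lra.
lra.
Qed.

End drift.

(** * Energy estimate along one trajectory, on the good event *)

Section analysis.
Context {R : realType} {d : nat} (f : 'rV[R]_d -> R) (L0 L1 A B C m : R).
Hypothesis df : forall x : 'rV[R]_d, differentiable f x.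
Hypotheses (L0_gt0 : 0 < L0) (L1_gt0 : 0 < L1) (A_gt0 : 0 < A) (B_gt0 : 0 < B) (C_gt0 : 0 < C).
Hypothesis smooth : L0L1_smooth L0 L1 f.
Hypothesis f_ge : forall x : 'rV[R]_d, m <= f x.
(** Here [D1] is the initial gap, [l] stands for [ln (T / delta)] and [q] for
    [sqrt (2 C) / sqrt (L0 T)]. The six constraints on [eta] are those of the minimum defining the
    step size, with denominators cleared and the two containing [sqrt T] squared. *)
Context (T : nat) (Dc D1 l q eta : R).
Let Tr : R := T%:R.
Let sigma := Num.sqrt (L0 * Dc + L1 ^+ 2 * Dc ^+ 2).
Let H := L0 + L1 * (L0 / (8 * L1) + 9 / 4 * sigma).
Let b2 := A * Dc + 4 * B * (L0 * Dc + L1 ^+ 2 * Dc ^+ 2) + C.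
Let G0 := Num.sqrt (A * Dc) + 2 * (Num.sqrt B + 1) * sigma + Num.sqrt C.
Let r := Num.sqrt Dc.
Hypotheses (T_gt0 : (0 < T)%N) (D1_ge0 : 0 <= D1) (l_ge0 : 0 <= l) (q_ge0 : 0 <= q).
Hypothesis qE : q ^+ 2 * (L0 * Tr) = 2 * C.
Hypothesis DcE : Dc = 8 * D1 + 8 + 32 * l ^+ 2 + 8 * q * l + 303 * L0 / (224 * L1 ^+ 2).
Hypothesis eta_gt0 : 0 < eta.
Hypothesis etaA : 16 * H * A * Tr * eta ^+ 2 <= 1.
Hypothesis etaB : 8 * H * (B + 1) * eta <= 1.
Hypothesis etaC : 4 * H * C * Tr * eta ^+ 2 <= 1.
Hypothesis etaG : 8 * L1 * G0 * eta <= 1.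
Hypothesis eta5 : 3 * (A + 4 * B * L0) * eta * r <= 1.
Hypothesis eta6 : 12 * B * L1 ^+ 2 * Dc * r * eta <= 1.

Let w := L0 / L1 ^+ 2.
(* A gap of at most [Dsafe] at [x_t] still gives a gap of at most [Dc] at any
   point within [1 / (8 * L1)] of [x_t], hence at [xbar_t]. *)
Let Dsafe := 5 / 8 * Dc - 303 / 1792 * w.

Let w_gt0 : 0 < w. Proof. by rewrite divr_gt0// exprn_gt0. Qed.

Let DcE' : Dc = 8 * D1 + 8 + 32 * l ^+ 2 + 8 * q * l + 303 / 224 * w.
Proof. by rewrite DcE /w; field; rewrite gt_eqF. Qed.

Let Dc_gt0 : 0 < Dc.
Proof.
rewrite DcE'; have := mulr_ge0 q_ge0 l_ge0; have := sqr_ge0 l; have := D1_ge0; have := w_gt0; lra.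
Qed.

Let s2E : sigma ^+ 2 = L0 * Dc + L1 ^+ 2 * Dc ^+ 2.
Proof. by rewrite sqr_sqrtr// addr_ge0// mulr_ge0// ?sqr_ge0// ltW. Qed.

Let sigma_ge0 : 0 <= sigma. Proof. exact: sqrtr_ge0. Qed.

Let H_ge : 9 / 8 * L0 <= H.
Proof.
rewrite /H; have -> : L0 + L1 * (L0 / (8 * L1) + 9 / 4 * sigma) =
  9 / 8 * L0 + L1 * sigma * (9 / 4) by field; rewrite gt_eqF.
by rewrite lerDl !mulr_ge0// ltW.
Qed.

Let H_gt0 : 0 < H. Proof. by apply: lt_le_trans H_ge; rewrite mulr_gt0. Qed.

Let H_grad (x : 'rV[R]_d) : enorm (grad f x) <= 2 * sigma -> L0 + L1 * enorm (grad f x) <= H.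
Proof.
move=> h; rewrite lerD2l ler_pM2l//.
have : 0 <= L0 / (8 * L1) by rewrite divr_ge0 ?mulr_ge0// ltW.
have := sigma_ge0; lra.
Qed.

Let b2_gt0 : 0 < b2.
Proof. by rewrite ltr_wpDl// -s2E addr_ge0// !mulr_ge0// ?sqr_ge0// ltW. Qed.

(** The term in [A] costs [Dc / 4] and the one in [C] costs 1. The last term is at most
    [(2 r + q) l], where [2 r l <= Dc / 4 + 4 l^2]. The sum [D1 + 1 + 4 l^2 + q l + Dc / 2] is
    exactly [Dsafe], by one eighth of the definition of [Dc]. *)
Lemma total_budget : D1 + 4 * H * eta ^+ 2 * (A * Dc + C) * Tr + 3 * eta * b2 * l <= Dsafe.
Proof.
have r2 : r ^+ 2 = Dc by rewrite sqr_sqrtr// ltW.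
have r0 : 0 <= r by exact: sqrtr_ge0.
have Tr0 : 0 < Tr by rewrite ltr0n.
(* Compared after squaring: [9 L0 <= 8 H], which is where the summand [L0 / (8 L1)] of [Mc] is
   needed, and [4 H C T eta^2 <= 1]. *)
have hC : 3 * eta * C <= q.
  have n3 : 0 <= 3 * eta * C by rewrite !mulr_ge0// ltW.
  rewrite -(@ler_pXn2r _ 2)//.
  have LT : 0 < L0 * Tr by exact: mulr_gt0.
  rewrite -(ler_pM2r LT) qE.
  have := ler_wpM2r (_ : 0 <= 2 * C) etaC; rewrite mul1r => /(_ _).
  have : 0 <= 8 * C ^+ 2 * Tr * eta ^+ 2 by rewrite !mulr_ge0 ?sqr_ge0// ltW.
  have : 9 / 8 * L0 * (8 * C ^+ 2 * Tr * eta ^+ 2) <= H * (8 * C ^+ 2 * Tr * eta ^+ 2).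
    by rewrite ler_wpM2r// !mulr_ge0 ?sqr_ge0// ltW.
  move=> h1 h2 h3; have {}h3 := h3 ltac:(by rewrite mulr_ge0// ltW).
  lra.
have h1 : 4 * H * eta ^+ 2 * (A * Dc) * Tr <= Dc / 4.
  have := ler_wpM2r (ltW Dc_gt0) etaA; lra.
have h2 : 4 * H * eta ^+ 2 * C * Tr <= 1 by move: etaC; lra.
have h3 : 3 * eta * b2 <= r + r + q.
  have := ler_wpM2r r0 eta5; have := ler_wpM2r r0 eta6; rewrite /b2.
  have -> : 12 * B * L1 ^+ 2 * Dc * r * eta * r = 12 * B * L1 ^+ 2 * Dc * (r ^+ 2) * eta by ring.
  have -> : 3 * (A + 4 * B * L0) * eta * r * r = 3 * (A + 4 * B * L0) * eta * r ^+ 2 by ring.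
  rewrite r2; lra.
have := ler_wpM2r l_ge0 h3.
have := sqr_ge0 (r / 2 - 2 * l).
have -> : (r / 2 - 2 * l) ^+ 2 = r ^+ 2 / 4 - 2 * r * l + 4 * l ^+ 2 by field.
rewrite r2 /Dsafe; have := DcE'; lra.
Qed.

Lemma grad_le_gap (x : 'rV[R]_d) : f x - m <= Dc -> enorm (grad f x) <= 2 * sigma.
Proof.
move=> h; rewrite -(@ler_pXn2r _ 2)// ?nnegrE ?enorm_ge0 ?mulr_ge0//.
apply: le_trans (grad_sqr_le_gap df L0_gt0 L1_gt0 smooth f_ge x) _.
rewrite exprMn s2E.
have x0 : 0 <= f x - m by rewrite subr_ge0.
have h1 : L0 * (f x - m) <= L0 * Dc by rewrite ler_wpM2l// ltW.
have h2 : L1 ^+ 2 * (f x - m) ^+ 2 <= L1 ^+ 2 * Dc ^+ 2.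
  by rewrite ler_wpM2l ?sqr_ge0// lerXn2r// nnegrE ltW.
lra.
Qed.

(** Descent from [x] to [y] with [L1 rho <= 1 / 8] gives a gap of at most [81/64 De + 9/64 w]. For
    [De <= Dsafe] the coefficient of [Dc] is below 1 and that of [w] is negative. *)
Lemma gap_near (x y : 'rV[R]_d) : f x - m <= Dsafe -> enorm (y - x) <= 1 / (8 * L1) ->
  f y - m <= Dc.
Proof.
set rho := enorm (y - x); set De := f x - m => hx hr.
have De0 : 0 <= De by rewrite subr_ge0.
have rho0 : 0 <= rho by exact: enorm_ge0.
have hr1 : L1 * rho <= 1 / 8.
  by have := ler_wpM2l (ltW L1_gt0) hr; rewrite (_ : L1 * (1 / _) = 1 / 8)//; field; rewrite gt_eqF.
have hrL : rho <= 1 / L1 by rewrite ler_pdivlMr// mulrC; lra.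
have := descent df smooth x (v := y - x) hrL; rewrite addrC subrK -/rho.
have := CauchySchwarz (grad f x) (y - x); rewrite -/rho.
set g := enorm (grad f x).
have g0 : 0 <= g by exact: enorm_ge0.
have L1w : L0 = L1 * (L1 * w) by rewrite /w; field; rewrite gt_eqF.
(* With [L0 = L1^2 w], the bound [4 (L0 De + L1^2 De^2)] on [g^2] falls short of the square
   [L1^2 (2 De + w)^2] by [L1^2 w^2]. *)
have hg : g <= L1 * (2 * De + w).
  have nn : 0 <= L1 * (2 * De + w).
    by apply: mulr_ge0; [exact: ltW|apply: addr_ge0; [exact: mulr_ge0|exact: ltW]].
  rewrite -(@ler_pXn2r _ 2)// ?nnegrE//.
  apply: le_trans (grad_sqr_le_gap df L0_gt0 L1_gt0 smooth f_ge x) _.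
  rewrite -/De {1}L1w; have : 0 <= L1 ^+ 2 * w ^+ 2 by rewrite mulr_ge0 ?sqr_ge0.
  lra.
have h1 : g * rho <= (2 * De + w) / 8.
  have e1 := ler_wpM2r rho0 hg.
  have e2 : (2 * De + w) * (L1 * rho) <= (2 * De + w) * (1 / 8).
    by rewrite ler_wpM2l//; apply: addr_ge0; [exact: mulr_ge0|exact: ltW].
  lra.
have h2 : L0 * rho ^+ 2 <= w / 64.
  rewrite L1w; have e1 : (L1 * rho) ^+ 2 <= (1 / 8) ^+ 2.
    by rewrite lerXn2r ?nnegrE ?mulr_ge0// ltW.
  have e2 := ler_wpM2l (ltW w_gt0) e1; lra.
have h3 : L1 * g * rho ^+ 2 <= (2 * De + w) / 64.
  have e1 : (g * rho) * (L1 * rho) <= (g * rho) * (1 / 8) by rewrite ler_wpM2l// mulr_ge0.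
  lra.
have := hx; rewrite /Dsafe -/De => hx' cs dsc.
have : f y - m <= De + g * rho + (L0 * rho ^+ 2 + L1 * g * rho ^+ 2) / 2.
  by rewrite /De; move: dsc; rewrite -/g; lra.
have := w_gt0; lra.
Qed.

(** The square root of the variance bound is at most the sum of the square roots of its terms;
    adding the gradient, at most [2 sigma], gives [G0]. *)
Lemma oracle_le (x g : 'rV[R]_d) : f x - m <= Dc ->
  enorm (g - grad f x) ^+ 2 <= A * (f x - m) + B * enorm (grad f x) ^+ 2 + C ->
  eta * enorm g <= 1 / (8 * L1).
Proof.
move=> hx hg; have gx := grad_le_gap hx.
have n0 : 0 <= enorm (grad f x) by exact: enorm_ge0.
have h1 : enorm (g - grad f x) <= Num.sqrt (A * Dc) + Num.sqrt B * (2 * sigma) + Num.sqrt C.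
  rewrite -(@ler_pXn2r _ 2)// ?nnegrE ?enorm_ge0//; last first.
    by rewrite !addr_ge0 ?mulr_ge0 ?sqrtr_ge0.
  apply: (le_trans hg).
  have e1 : A * (f x - m) <= Num.sqrt (A * Dc) ^+ 2.
    rewrite sqr_sqrtr; first by rewrite ler_wpM2l// ltW.
    by rewrite mulr_ge0// ltW.
  have e2 : B * enorm (grad f x) ^+ 2 <= (Num.sqrt B * (2 * sigma)) ^+ 2.
    rewrite exprMn [Num.sqrt B ^+ 2]sqr_sqrtr; last exact: ltW.
    apply: ler_wpM2l; first exact: ltW.
    by apply: lerXn2r; rewrite // nnegrE ?enorm_ge0// mulr_ge0.
  have e3 : C = Num.sqrt C ^+ 2 by rewrite sqr_sqrtr// ltW.
  rewrite [in leLHS]e3.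
  move: e1 e2; set u := Num.sqrt (A * Dc); set v := Num.sqrt B * (2 * sigma); set t := Num.sqrt C.
  have u0 : 0 <= u by exact: sqrtr_ge0.
  have t0 : 0 <= t by exact: sqrtr_ge0.
  have v0 : 0 <= v by rewrite mulr_ge0 ?sqrtr_ge0 ?mulr_ge0.
  have := mulr_ge0 u0 v0; have := mulr_ge0 u0 t0; have := mulr_ge0 v0 t0; lra.
have h2 : enorm g <= G0.
  rewrite -[g](subrK (grad f x)); apply: le_trans (enormD _ _) _.
  by rewrite /G0; lra.
rewrite ler_pdivlMr ?mulr_gt0//.
have := ler_wpM2r (_ : 0 <= 8 * L1) (ler_wpM2l (ltW eta_gt0) h2).
by rewrite ?mulr_ge0 ?(ltW L1_gt0)// => /(_ isT); move: etaG; lra.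
Qed.

(** Descent at [x] involves the gradient at [x]; exchanging it for the one at [xb] costs
    [H rho eta n], split by Young into halves of [H rho^2] and [H eta^2 n^2]. The second half joins
    the quadratic term of descent. *)
Lemma one_step (x xb g : 'rV[R]_d) : f x - m <= Dsafe ->
  enorm (xb - x) <= 1 / (8 * L1) -> eta * enorm g <= 1 / (8 * L1) ->
  f (x - eta *: g) <= f x - eta * dot (grad f xb) g
    + H * eta ^+ 2 * enorm g ^+ 2 + H / 2 * enorm (xb - x) ^+ 2.
Proof.
move=> hx hxb hg.
have hD : Dsafe <= Dc by rewrite /Dsafe; have := w_gt0; have := Dc_gt0; lra.
have gx := H_grad (grad_le_gap (le_trans hx hD)).
have gxb := H_grad (grad_le_gap (gap_near hx hxb)).
have small : 1 / (8 * L1) <= 1 / L1.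
  rewrite !div1r lef_pV2 ?posrE ?mulr_gt0//; have := L1_gt0; lra.
have ng : enorm (- (eta *: g)) = eta * enorm g by rewrite enormN enormZ gtr0_norm.
have := descent df smooth x (v := - (eta *: g)).
rewrite ng => /(_ (le_trans hg small)).
rewrite dotNr dotZr; set n := enorm g in hg ng *; set rho := enorm (xb - x).
have n0 : 0 <= n by exact: enorm_ge0.
have rho0 : 0 <= rho by exact: enorm_ge0.
have h1 : eta * dot (grad f xb - grad f x) g <= H * (rho * (eta * n)).
  have sm := smooth (le_trans hxb small).
  have e1 : enorm (grad f xb - grad f x) <= H * rho.
    by apply: (le_trans sm); rewrite ler_wpM2r.
  have := ler_wpM2l (ltW eta_gt0) (CauchySchwarz (grad f xb - grad f x) g).
  have := ler_wpM2l (ltW eta_gt0) (ler_wpM2r n0 e1); rewrite -/n; lra.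
have h2 : 0 <= H * (rho - eta * n) ^+ 2 by rewrite mulr_ge0 ?sqr_ge0// ltW.
have h3 : (L0 + L1 * enorm (grad f x)) / 2 * (eta * n) ^+ 2 <= H / 2 * (eta * n) ^+ 2.
  by rewrite ler_wpM2r ?sqr_ge0// ler_pM2r.
rewrite dotDl dotNl in h1; lra.
Qed.

Context (x xb D g : nat -> 'rV[R]_d) (a b : nat -> R).
Hypothesis x0 : f (x 0) - m = D1.
Hypothesis xS : forall n, (n < T)%N -> x n.+1 = x n - eta *: g n.
Hypothesis xbE : forall n, (n < T)%N -> xb n = x n + (1 - a n) *: D n.
Hypothesis D0 : D 0 = 0.
Hypothesis DS : forall n, (n < T)%N -> D n.+1 = (1 - a n) *: D n - (b n * eta) *: g n.
Hypothesis params :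
  (forall n, (n < T)%N -> 0 < a n <= 1 /\ b n = 0) \/
  (forall n, (n < T)%N -> a n = 2 / (n%:R + 2) /\ b n = a n).
Hypothesis noise : forall n, (n < T)%N ->
  enorm (g n - grad f (xb n)) ^+ 2 <=
    A * (f (xb n) - m) + B * enorm (grad f (xb n)) ^+ 2 + C.
Let mu := (3 * b2)^-1.
Hypothesis mart : forall n, (n < T)%N ->
  \sum_(k < n.+1) (if f (xb k) - m <= Dc then
    - mu * dot (grad f (xb k)) (g k - grad f (xb k))
    - mu / 4 * enorm (grad f (xb k)) ^+ 2 else 0) <= l.

Let good k := [/\ f (x k) - m <= Dsafe, enorm (xb k - x k) <= 1 / (8 * L1)
  & eta * enorm (g k) <= 1 / (8 * L1)].

Let telescope n : (n <= T)%N -> (forall k, (k < n)%N -> good k) ->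
  f (x n) - m <= D1 + \sum_(k < n) (- eta * dot (grad f (xb k)) (g k)
    + H * eta ^+ 2 * enorm (g k) ^+ 2 + H / 2 * enorm (xb k - x k) ^+ 2).
Proof.
elim: n => [|n IHn] nT hg; first by rewrite big_ord0 addr0 x0.
rewrite big_ord_recr/= xS//.
have := IHn (ltnW nT) (fun k kn => hg k (ltnW kn)).
have [h1 h2 h3] := hg n (leqnn _).
have := one_step h1 h2 h3; lra.
Qed.

(** Balance of [eta Sn]: -1 from the inner products, +1/4 from the martingale bound, and +1/2 from
    [2 H eta^2 Sg], which collects oracle norms and drifts, by [8 H (B + 1) eta <= 1]. What remains
    is -1/4. *)
Lemma energy n : (n <= T)%N -> (forall k, (k < n)%N -> good k) ->
  f (x n) - m + eta / 4 * \sum_(k < n) enorm (grad f (xb k)) ^+ 2 <=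
  D1 + 4 * H * eta ^+ 2 * (A * Dc + C) * n%:R + 3 * eta * b2 * l.
Proof.
move=> nT hg.
have := telescope nT hg.
rewrite !big_split/= -!mulr_sumr.
have gap (k : 'I_n) : f (xb k) - m <= Dc.
  by have [h1 h2 _] := hg k (ltn_ord k); exact: gap_near h1 h2.
set Sx := \sum_(k < n) enorm (xb k - x k) ^+ 2.
set Sg := \sum_(k < n) enorm (g k) ^+ 2.
set Sn := \sum_(k < n) enorm (grad f (xb k)) ^+ 2.
pose Sd := \sum_(k < n) dot (grad f (xb k)) (g k - grad f (xb k)).
have -> : \sum_(k < n) dot (grad f (xb k)) (g k) = Sd + Sn.
  rewrite -big_split/=; apply: eq_bigr => k _.
  by rewrite enorm_sqr dotDr dotNr subrK.
have hx : Sx <= 2 * eta ^+ 2 * Sg.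
  have := drift_sum (ltW eta_gt0) D0 DS params nT; apply: le_trans.
  apply: ler_sum => k _; rewrite xbE ?(leq_trans (ltn_ord k))//.
  by rewrite [x k + _]addrC addrK.
have hSg : Sg <= 2 * (1 + B) * Sn + 2 * (A * Dc + C) * n%:R.
  have -> : 2 * (A * Dc + C) * n%:R = \sum_(k < n) 2 * (A * Dc + C).
    by rewrite sumr_const card_ord mulr_natr.
  rewrite mulr_sumr -big_split/=; apply: ler_sum => k _.
  have := noise (leq_trans (ltn_ord k) nT).
  have := enormD_sqr (g k - grad f (xb k)) (grad f (xb k)); rewrite subrK.
  have := ler_wpM2l (ltW A_gt0) (gap k); lra.
have Sn0 : 0 <= Sn by apply: sumr_ge0 => k _; exact: sqr_ge0.
(* All gaps are at most [Dc], so the truncation in [mart] is inactive. The empty sum is treated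
   apart, as [mart] starts with one summand. *)
have hm : mu * (- Sd - Sn / 4) <= l.
  have -> : mu * (- Sd - Sn / 4) = \sum_(k < n) (if f (xb k) - m <= Dc then
    - mu * dot (grad f (xb k)) (g k - grad f (xb k))
    - mu / 4 * enorm (grad f (xb k)) ^+ 2 else 0).
    under eq_bigr => k _ do rewrite gap.
    by rewrite big_split/= -mulr_sumr sumrN -mulr_sumr -/Sn -/Sd; ring.
  case: (n) nT => [|n'] nT'; last exact: mart.
  by rewrite big_ord0.
have {}hm : - Sd - Sn / 4 <= 3 * b2 * l.
  by move: hm; rewrite /mu ler_pdivrMl ?mulr_gt0.
have {}hm := ler_wpM2l (ltW eta_gt0) hm.
have hB := ler_wpM2r (mulr_ge0 (ltW eta_gt0) Sn0) etaB.
have h4 : 2 * H * eta ^+ 2 * Sg <=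
  2 * H * eta ^+ 2 * (2 * (1 + B) * Sn + 2 * (A * Dc + C) * n%:R).
  by rewrite ler_wpM2l// !mulr_ge0 ?sqr_ge0// ltW.
have h5 : H / 2 * Sx <= H / 2 * (2 * eta ^+ 2 * Sg).
  by rewrite ler_wpM2l// divr_ge0// ltW.
lra.
Qed.

Let energy_budget n : (n <= T)%N ->
  D1 + 4 * H * eta ^+ 2 * (A * Dc + C) * n%:R + 3 * eta * b2 * l <= Dsafe.
Proof.
move=> nT; apply: le_trans total_budget; rewrite lerD2r lerD2l ler_wpM2l ?ler_nat//.
apply: mulr_ge0; last by apply: addr_ge0; [apply: mulr_ge0|]; exact: ltW.
by apply: mulr_ge0; [apply: mulr_ge0 => //; exact: ltW|exact: sqr_ge0].
Qed.

(** Order of the induction: earlier oracle steps bound the drift, which puts [xb k] near [x k]; the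
    gap at [xb k] is then at most [Dc], which bounds the oracle step [k]; energy and budget give the
    gap at [x k.+1]. *)
Lemma iterates_good n : (n < T)%N -> good n.
Proof.
suff inv k : (k <= T)%N -> f (x k) - m <= Dsafe /\ forall j, (j < k)%N -> good j.
  by move=> nT; have [_] := inv n.+1 nT; apply.
have e0 : 0 <= 1 / (8 * L1) by rewrite divr_ge0// mulr_ge0// ltW.
elim: k => [|k IHk] kT.
  split => //; rewrite x0; apply: le_trans (energy_budget (leq0n T)).
  rewrite mulr0 addr0 lerDl; apply: mulr_ge0 => //; apply: mulr_ge0; last exact: ltW.
  by apply: mulr_ge0 => //; exact: ltW.
have [hk hj] := IHk (ltnW kT).
have gk : good k.
  have hD : enorm (D k) <= 1 / (8 * L1).
    apply: (drift_le (ltW eta_gt0) D0 DS params e0 (ltnW kT)) => i ik.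
    by have [] := hj i ik.
  have hxb : enorm (xb k - x k) <= 1 / (8 * L1).
    rewrite xbE// [x k + _]addrC addrK enormZ.
    have /andP[a0 a1] := drift_weight params kT.
    rewrite ger0_norm ?subr_ge0//; apply: le_trans hD.
    by rewrite ler_piMl ?enorm_ge0// gerBl.
  by split => //; apply: oracle_le (gap_near hk hxb) (noise kT).
have hj' j : (j < k.+1)%N -> good j.
  by rewrite ltnS leq_eqVlt => /predU1P[->|/hj].
split => //.
apply: le_trans (energy_budget kT); apply: le_trans (energy kT hj').
rewrite lerDl mulr_ge0 ?divr_ge0 ?(ltW eta_gt0)//.
by apply: sumr_ge0 => i _; exact: sqr_ge0.
Qed.

Lemma sum_grad_le : eta / 4 * \sum_(k < T) enorm (grad f (xb k)) ^+ 2 <=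
  D1 + 4 * H * eta ^+ 2 * (A * Dc + C) * Tr + 3 * eta * b2 * l.
Proof.
apply: le_trans (energy (leqnn T) iterates_good).
by rewrite lerDr subr_ge0.
Qed.

End analysis.

(** * Concentration of the noise *)

Lemma rowB {R : realType} {d : nat} (u v : 'rV[R]_d) i : (u - v) 0 i = u 0 i - v 0 i.
Proof. by rewrite !mxE. Qed.

Lemma measurable_dot {R : realType} {d : nat} {dY} {Y : measurableType dY}
    (U V : Y -> 'rV[R]_d) :
  (forall i, measurable_fun setT (fun y => U y 0 i)) ->
  (forall i, measurable_fun setT (fun y => V y 0 i)) ->
  measurable_fun setT (fun y => dot (U y) (V y)).
Proof.
by move=> mU mV; apply: measurable_sum => i; apply: measurable_funM.
Qed.

Section score.
Context {R : realType} {d : nat} {dZ : measure_display} {Z : measurableType dZ}.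
Context (D : probability Z R) (fz : 'rV[R]_d -> Z -> R) (f : 'rV[R]_d -> R).
Hypothesis mfz : forall x, measurable_fun setT (fz x).
Hypothesis dfz : forall z x, differentiable (fz ^~ z) x.
Hypothesis df : forall x : 'rV[R]_d, differentiable f x.
Hypothesis unbiased : unbiased_oracle D fz f.
Context (A B C m Dc s2 : R).
Hypotheses (A_ge0 : 0 <= A) (B_ge0 : 0 <= B) (C_gt0 : 0 < C) (Dc_ge0 : 0 <= Dc) (s2_ge0 : 0 <= s2).
Hypothesis grad_le : forall x, f x - m <= Dc -> enorm (grad f x) ^+ 2 <= 4 * s2.

Let b2 := A * Dc + 4 * B * s2 + C.
Let mu := (3 * b2)^-1.
Let G x z := grad (fz ^~ z) x.

Definition variance_cond (x : 'rV[R]_d) (z : Z) : bool :=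
  enorm (G x z - grad f x) ^+ 2 <= A * (f x - m) + B * enorm (grad f x) ^+ 2 + C.

(* Truncating at gap [Dc] makes the noise bounded without a stopping time. *)
Definition score (x : 'rV[R]_d) (z : Z) : R :=
  if f x - m <= Dc then - mu * dot (grad f x) (G x z - grad f x)
    - mu / 4 * enorm (grad f x) ^+ 2 else 0.

Hypothesis variance : forall x, {ae D, forall z, variance_cond x z}.

Let b2_gt0 : 0 < b2.
Proof. by apply: ltr_wpDl => //; rewrite addr_ge0// !mulr_ge0. Qed.

Let mu_gt0 : 0 < mu. Proof. by rewrite invr_gt0 mulr_gt0. Qed.

Section measurability.
Context {dY : measure_display} {Y : measurableType dY} (X : Y -> 'rV[R]_d) (h : Y -> Z).
Hypotheses (mX : forall i, measurable_fun setT (fun y => X y 0 i)) (mh : measurable_fun setT h).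

Lemma measurable_oracle i : measurable_fun setT (fun y => G (X y) (h y) 0 i).
Proof. exact: measurable_grad. Qed.

Let measurable_gap : measurable_fun setT (fun y => f (X y) - m).
Proof. by apply: measurable_funB => //; exact: measurable_row_fun. Qed.

Let measurable_noise i : measurable_fun setT (fun y => (G (X y) (h y) - grad f (X y)) 0 i).
Proof.
under eq_fun do rewrite rowB; apply: measurable_funB; first exact: measurable_oracle.
exact: measurable_row_grad.
Qed.

Lemma measurable_grad_sqr : measurable_fun setT (fun y => enorm (grad f (X y)) ^+ 2).
Proof.
under eq_fun do rewrite enorm_sqr.
by apply: measurable_dot => i; exact: measurable_row_grad.
Qed.

Lemma measurable_variance_cond : measurable_fun setT (fun y => variance_cond (X y) (h y)).
Proof.
apply: measurable_fun_ler.
  under eq_fun do rewrite enorm_sqr.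
  by apply: measurable_dot => i; exact: measurable_noise.
apply: measurable_funD => //; apply: measurable_funD; apply: measurable_funM => //.
exact: measurable_grad_sqr.
Qed.

Lemma measurable_score : measurable_fun setT (fun y => score (X y) (h y)).
Proof.
apply: measurable_fun_ifT => //; first exact: measurable_fun_ler.
apply: measurable_funB; apply: measurable_funM => //; last exact: measurable_grad_sqr.
by apply: measurable_dot => i; [exact: measurable_row_grad|exact: measurable_noise].
Qed.

End measurability.

Lemma oracle_noise_mean (x v : 'rV[R]_d) :
  D.-integrable setT (fun z => (dot v (G x z - grad f x))%:E) /\
  (\int[D]_z (dot v (G x z - grad f x))%:E = 0)%E.
Proof.
have iG i : D.-integrable setT (fun z => (G x z 0 i)%:E) by have [] := unbiased x i.
have ib i : D.-integrable setT (fun z => ((G x z - grad f x) 0 i)%:E).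
  have -> : (fun z => ((G x z - grad f x) 0 i)%:E) =
    (fun z => (G x z 0 i)%:E - (grad f x 0 i)%:E)%E by apply/funext => z; rewrite rowB.
  by apply: integrableB => //; exact: finite_measure_integrable_cst.
have it i : D.-integrable setT (fun z => (v 0 i)%:E * ((G x z - grad f x) 0 i)%:E)%E.
  exact: integrableZl.
have E z : (dot v (G x z - grad f x))%:E =
    (\sum_(i < d) (v 0 i)%:E * ((G x z - grad f x) 0 i)%:E)%E.
  by rewrite -sumEFin; apply: eq_bigr => i _; rewrite EFinM.
split; first by under eq_fun do rewrite E; exact: integrable_sum.
under eq_integral do rewrite E.
rewrite integral_sum//; apply: big1 => i _; rewrite integralZl//.
have -> : (\int[D]_z ((G x z - grad f x) 0 i)%:E = 0)%E; last by rewrite mule0.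
under eq_integral do rewrite rowB EFinD.
rewrite integralD//; last exact: finite_measure_integrable_cst.
rewrite integral_cst//= (_ : D setT = 1%E) ?mule1; last exact: probability_setT.
have [_] := unbiased x i; rewrite unlock => ->.
by rewrite -EFinD subrr.
Qed.

(** Hoeffding with radius [a = mu |gx| sqrt b2] produces the exponent [3/4 a^2]. The choice
    [mu b2 = 1/3] makes it [mu / 4 |gx|^2], exactly the compensator subtracted in [score]. *)
Lemma score_mgf (x : 'rV[R]_d) : (\int[D]_z (expR (score x z))%:E <= 1)%E.
Proof.
rewrite /score; have [gap|gap] := boolP (f x - m <= Dc); last first.
  by rewrite expR0 integral_cst// mul1e; apply: probability_le1.
set gx := grad f x; set n2 := enorm gx ^+ 2.
pose X z := - mu * dot gx (G x z - gx).
pose a := mu * (enorm gx * Num.sqrt b2).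
have [id0 d0] := oracle_noise_mean x gx.
have iX : D.-integrable setT (EFin \o X).
  have -> : EFin \o X = (fun z => (- mu)%:E * (dot gx (G x z - gx))%:E)%E.
    by apply/funext => z; rewrite /= -EFinM.
  exact: integrableZl.
have X0 : (\int[D]_z (X z)%:E = 0)%E.
  by under eq_integral do rewrite /X EFinM; rewrite integralZl// d0 mule0.
have a0 : 0 <= a by rewrite !mulr_ge0 ?enorm_ge0 ?sqrtr_ge0// ltW.
have Xa : {ae D, forall z, `|X z| <= a}.
  apply: filterS (variance x) => z; rewrite /variance_cond -/gx => hz.
  rewrite /X /a normrM normrN (ger0_norm (ltW mu_gt0)) ler_pM2l//.
  apply: le_trans (dot_norm_le _ _) _; rewrite ler_wpM2l ?enorm_ge0//.
  rewrite -(@ler_pXn2r _ 2)// ?nnegrE ?enorm_ge0 ?sqrtr_ge0// [leRHS]sqr_sqrtr ?(ltW b2_gt0)//.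
  apply: (le_trans hz); rewrite /b2.
  have := ler_wpM2l A_ge0 gap; have := ler_wpM2l B_ge0 (grad_le gap); rewrite -/gx; lra.
have mgf := hoeffding_lemma a0 iX X0 Xa.
under eq_integral do rewrite expRD EFinM.
have mX : measurable_fun setT X by apply/measurable_EFinP; case/integrableP: iX.
rewrite ge0_integralZr//; last by apply/measurable_EFinP; exact: measurableT_comp.
apply: le_trans (lee_wpmul2r _ mgf) _; first by rewrite lee_fin expR_ge0.
rewrite -EFinM -expRD lee_fin -[leRHS]expR0 ler_expR.
have -> : a ^+ 2 = mu / 3 * n2.
  rewrite /a !exprMn [Num.sqrt b2 ^+ 2]sqr_sqrtr ?(ltW b2_gt0)// -/n2.
  by rewrite /mu; field; rewrite gt_eqF.
lra.
Qed.

End score.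

(** * The exponential supermartingale along the random iterates *)

Section process.
Context {R : realType} {d : nat} {dZ : measure_display} {Z : measurableType dZ}.
Context (D : probability Z R) (fz : 'rV[R]_d -> Z -> R) (f : 'rV[R]_d -> R).
Hypothesis mfz : forall x, measurable_fun setT (fz x).
Hypothesis dfz : forall z x, differentiable (fz ^~ z) x.
Hypothesis df : forall x : 'rV[R]_d, differentiable f x.
Context (x1 : 'rV[R]_d) (alpha theta gamma : nat -> R).

Let G x z := grad (fz ^~ z) x.
(** Index shifted by one: [xb zeta n] depends on samples 1 to [n] and is the query point for sample
    [n + 1]. *)
Let xb (zeta : nat -> Z) n := agd_xbar G x1 alpha theta gamma zeta n.+1.

(** [Y] is kept abstract because the iterates are needed both on [Omega] and on the product of [Z]
    with the history sigma-algebra. *)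
Section measurability.
Context {dY : measure_display} {Y : measurableType dY} (zeta : nat -> Y -> Z) (n : nat).
Hypothesis mzeta : forall j, (1 <= j <= n)%N -> measurable_fun setT (zeta j).

Let iter y k := agd_iter G x1 alpha theta gamma (fun j => zeta j y) k.

Let measurable_mid k : (forall i, measurable_fun setT (fun y => (iter y k).1 0 i)) ->
  (forall i, measurable_fun setT (fun y => (iter y k).2 0 i)) ->
  forall i, measurable_fun setT (fun y => agd_mid alpha k.+1 (iter y k) 0 i).
Proof.
move=> m1 m2 i; rewrite /agd_mid.
by under eq_fun do rewrite !mxE; apply: measurable_funD; apply: measurable_funM.
Qed.

Lemma measurable_agd_iter k : (k <= n)%N ->
  (forall i, measurable_fun setT (fun y => (iter y k).1 0 i)) /\
  (forall i, measurable_fun setT (fun y => (iter y k).2 0 i)).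
Proof.
elim: k => [|k IHk] kn; first by split=> i; exact: measurable_cst.
have [m1 m2] := IHk (ltnW kn).
have mm := measurable_mid m1 m2.
have mG i : measurable_fun setT
    (fun y => G (agd_mid alpha k.+1 (iter y k)) (zeta k.+1 y) 0 i).
  by apply: measurable_oracle => //; exact: mzeta.
have E1 y i : (iter y k.+1).1 0 i = (iter y k).1 0 i
    - theta k.+1 * G (agd_mid alpha k.+1 (iter y k)) (zeta k.+1 y) 0 i.
  by rewrite rowB [X in _ - X = _]mxE.
have E2 y i : (iter y k.+1).2 0 i = agd_mid alpha k.+1 (iter y k) 0 i
    - gamma k.+1 * G (agd_mid alpha k.+1 (iter y k)) (zeta k.+1 y) 0 i.
  by rewrite rowB [X in _ - X = _]mxE.
split=> i.
- by under eq_fun do rewrite E1; apply: measurable_funB => //; apply: measurable_funM.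
- by under eq_fun do rewrite E2; apply: measurable_funB => //; apply: measurable_funM.
Qed.

Lemma measurable_xbar k : (k <= n)%N ->
  forall i, measurable_fun setT (fun y => xb (fun j => zeta j y) k 0 i).
Proof. by move=> kn; have [m1 m2] := measurable_agd_iter kn; exact: measurable_mid. Qed.

End measurability.

Hypothesis unbiased : unbiased_oracle D fz f.
Context (A B C m Dc s2 : R).
Hypotheses (A_ge0 : 0 <= A) (B_ge0 : 0 <= B) (C_gt0 : 0 < C) (Dc_ge0 : 0 <= Dc) (s2_ge0 : 0 <= s2).
Hypothesis grad_le : forall x, f x - m <= Dc -> enorm (grad f x) ^+ 2 <= 4 * s2.
Hypothesis variance : forall x, {ae D, forall z, variance_cond fz f A B C m x z}.

Let sc := score fz f A B C m Dc s2.
Let vc := variance_cond fz f A B C m.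
Let S zeta n : R := \sum_(k < n) sc (xb zeta k) (zeta k.+1).

Lemma measurable_total_score {dY} {Y : measurableType dY} (zeta : nat -> Y -> Z) n :
  (forall j, (1 <= j <= n)%N -> measurable_fun setT (zeta j)) ->
  measurable_fun setT (fun y => S (fun j => zeta j y) n).
Proof.
move=> mz; apply: measurable_sum => k; apply: measurable_score => //.
  by apply: (@measurable_xbar _ _ _ n) => //; exact: ltnW.
by apply: mz => /=.
Qed.

Context {dO : measure_display} {Omega : measurableType dO} (P : probability Omega R).
Context (T : nat) (z : nat -> {RV P >-> Z}).
Hypothesis iid : iid_samples D T z.

(** Supermartingale step: with the past frozen, integrating the last factor over the fresh sample
    gives at most 1 by [score_mgf]. *)
Lemma total_score_mgf n : (n <= T)%N ->
  (\int[P]_w (expR (S (fun j => z j w) n))%:E <= 1)%E.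
Proof.
elim: n => [|n IHn] nT.
  under eq_integral do rewrite /S big_ord0 expR0.
  by rewrite integral_cst// mul1e; apply: probability_le1.
pose OG := g_sigma_algebraType (past z n).
pose H (p : OG * Z) : \bar R := (expR (S (fun j => z j p.1) n)
  * expR (sc (xb (fun j => z j p.1) n) p.2))%:E.
have mz j : (1 <= j <= n)%N -> measurable_fun [set: OG] (z j : Omega -> Z).
  exact: measurable_past.
have mz1 j : (1 <= j <= n)%N -> measurable_fun [set: (OG * Z)%type] (fun p => z j p.1).
  by move=> jn; apply: (measurableT_comp (mz j jn)); exact: measurable_fst.
have mH : measurable_fun setT H.
  apply/measurable_EFinP; apply: measurable_funM; apply: measurableT_comp => //.
    exact: (@measurable_total_score _ (OG * Z)%type (fun j p => z j p.1)).
  apply: measurable_score => //.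
  exact: (@measurable_xbar _ (OG * Z)%type (fun j p => z j p.1) n).
have H0 p : (0 <= H p)%E by rewrite lee_fin mulr_ge0 ?expR_ge0.
have -> : (\int[P]_w (expR (S (fun j => z j w) n.+1))%:E = \int[P]_w H (w, z n.+1 w))%E.
  by apply: eq_integral => w _; rewrite /S big_ord_recr/= expRD.
rewrite (integral_past iid nT mH H0); apply: le_trans (IHn (ltnW nT)).
apply: ge0_le_integral => //.
- by move=> w _; apply: integral_ge0.
(* The inner integral is measurable for the history, hence on [Omega] through the identity map. *)
- have mF := @measurable_fun_fubini_tonelli_F _ _ _ _ _ D H mH H0.
  exact: (measurableT_comp mF (measurable_id_sub (@past_measurable _ _ _ _ _ P z n))).
- apply/measurable_EFinP; apply: measurableT_comp => //.
  by apply: (@measurable_total_score _ Omega (fun j w => z j w)) => j _; exact: measurable_funP.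
move=> w _; rewrite /H/=; under eq_integral do rewrite EFinM.
rewrite ge0_integralZl//; last 1 first.
  apply/measurable_EFinP; apply: measurableT_comp => //.
  set v := xb _ _.
  exact: (measurable_score mfz dfz df A B C m Dc s2 (X := fun=> v) (h := id)).
rewrite -[leRHS]mule1 lee_wpmul2l// ?lee_fin ?expR_ge0//.
exact: score_mgf.
Qed.

(** Chernoff with parameter 1, since [mu] is already built into the score. *)
Lemma total_score_tail n (l : R) : (n <= T)%N ->
  (P [set w | (l <= S (fun j => z j w) n)%R] <= (expR (- l))%:E)%E.
Proof.
move=> nT.
have mS : measurable_fun setT (fun w => S (fun j => z j w) n).
  by apply: (@measurable_total_score _ Omega (fun j w => z j w)) => j _; exact: measurable_funP.
pose X : {RV P >-> R} := HB.pack (fun w => S (fun j => z j w) n)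
  (isMeasurableFun.Build _ _ _ _ _ mS).
have := @chernoff _ _ _ P X 1 l ltr01; rewrite mul1r => /le_trans; apply.
rewrite -[leRHS]mul1e lee_wpmul2r ?lee_fin ?expR_ge0//.
rewrite /mmt_gen_fun unlock.
have := total_score_mgf nT; congr (_ <= _)%E; apply: eq_integral => w _ /=.
by rewrite mulr1.
Qed.

(** The null set of the variance assumption depends on the point, which is random here; independence
    of the fresh sample from the past lets it be applied pointwise under the outer integral. *)
Lemma variance_ae n : (n < T)%N ->
  P [set w | ~~ vc (xb (fun j => z j w) n) (z n.+1 w)] = 0%E.
Proof.
move=> nT; set N := [set w | _].
pose OG := g_sigma_algebraType (past z n).
pose b (p : OG * Z) := vc (xb (fun j => z j p.1) n) p.2.
pose H (p : OG * Z) : \bar R := (if b p then 0 else 1 : R)%:E.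
have mz j : (1 <= j <= n)%N -> measurable_fun [set: OG] (z j : Omega -> Z).
  exact: measurable_past.
have mz1 j : (1 <= j <= n)%N -> measurable_fun [set: (OG * Z)%type] (fun p => z j p.1).
  by move=> jn; apply: (measurableT_comp (mz j jn)); exact: measurable_fst.
have mb : measurable_fun setT b.
  apply: measurable_variance_cond => //.
  exact: (@measurable_xbar _ (OG * Z)%type (fun j p => z j p.1) n).
have mH : measurable_fun setT H.
  by apply/measurable_EFinP; apply: measurable_fun_ifT.
have H0 p : (0 <= H p)%E by rewrite lee_fin; case: ifP.
have mN : measurable N.
  have : measurable_fun setT (fun w => ~~ vc (xb (fun j => z j w) n) (z n.+1 w)).
    apply: measurable_neg; apply: measurable_variance_cond => //.
    by apply: (@measurable_xbar _ Omega (fun j w => z j w) n) => // j _; exact: measurable_funP.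
  by move=> /(_ measurableT [set true] I); rewrite setTI.
rewrite -[N]setIT -integral_indic//.
have -> : (\int[P]_w (\1_N w)%:E = \int[P]_w H (w, z n.+1 w))%E.
  apply: eq_integral => w _; rewrite /H /b indicE.
  case: ifPn => h; [rewrite memNset//|rewrite mem_set//].
  by rewrite /N/= => /negP; apply.
rewrite (integral_past iid nT mH H0); apply: integral0_eq => w _.
rewrite -[RHS](@integral0 _ _ _ D setT); apply: ae_eq_integral => //.
- by apply: (measurableT_comp mH); exact: measurable_pair1.
- by apply: filterS (variance (xb (fun j => z j w) n)) => y hy _; rewrite /H /b /vc hy.
Qed.

(** Union bound over the steps: failure of the variance bound has probability zero and each partial
    sum reaches [l] with probability at most [expR (- l)]. *)
Lemma high_probability (l : R) (E : set Omega) : measurable E ->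
  (forall w, (forall n, (n < T)%N -> vc (xb (fun j => z j w) n) (z n.+1 w)) ->
    (forall n, (n < T)%N -> S (fun j => z j w) n.+1 <= l) -> E w) ->
  ((1 - T%:R * expR (- l))%:E <= P E)%E.
Proof.
move=> mE hE.
pose N n := [set w | ~~ vc (xb (fun j => z j w) n) (z n.+1 w)].
pose M n := [set w | l <= S (fun j => z j w) n.+1].
have mzw n j : (1 <= j <= n)%N -> measurable_fun setT (fun w : Omega => z j w).
  by move=> _; exact: measurable_funP.
have mN n : measurable (N n).
  have : measurable_fun setT (fun w => ~~ vc (xb (fun j => z j w) n) (z n.+1 w)).
    apply: measurable_neg; apply: measurable_variance_cond => //.
    exact: (@measurable_xbar _ Omega (fun j w => z j w) n (mzw n)).
  by move=> /(_ measurableT [set true] I); rewrite setTI.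
have mM n : measurable (M n).
  have : measurable_fun setT (fun w => l <= S (fun j => z j w) n.+1).
    apply: measurable_fun_ler => //.
    exact: (@measurable_total_score _ Omega (fun j w => z j w) n.+1 (mzw n.+1)).
  by move=> /(_ measurableT [set true] I); rewrite setTI.
have mU : measurable (\big[setU/set0]_(n < T) (N n `|` M n)).
  by apply: bigsetU_measurable => n _; exact: measurableU.
have sub : ~` E `<=` \big[setU/set0]_(n < T) (N n `|` M n).
  move=> w; rewrite -(bigcup_mkord T (fun n => N n `|` M n)).
  apply: contra_notP => h; apply: hE => n nT.
    by apply: contra_notT h => hw; exists n => //; left.
  by apply: contra_notT h => hw; exists n => //; right; apply: ltW; rewrite ltNge.
have le_delta : (P (~` E) <= (T%:R * expR (- l))%:E)%E.
  apply: le_trans (le_measure P _ _ sub) _; rewrite ?inE//; first exact: measurableC.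
  apply: le_trans (Boole_inequality P (A := fun n => N n `|` M n) (n := T) _) _.
    by move=> n _; exact: measurableU.
  apply: (@le_trans _ _ (\sum_(n < T) (expR (- l))%:E)%E).
    apply: lee_sum => n _; apply: le_trans (measureU2 P (mN n) (mM n)) _.
    rewrite [X in (X + _)%E](_ : _ = 0%E) ?add0e; last exact: variance_ae.
    exact: total_score_tail.
  by rewrite sumEFin sumr_const card_ord mulr_natl.
have PE : P E = (1 - P (~` E))%E by rewrite -probability_setC ?setCK//; exact: measurableC.
rewrite PE EFinB leeB//.
Qed.

End process.

(** * Step size and conclusion *)

Section numeric.
Context {R : realType}.

(** The inverse of a minimum is the maximum of the inverses, bounded here by their sum. This is how
    the minimum defining the step size becomes a sum in the rate. *)
Lemma minV_step (v e eta : R) : 0 < v -> 0 < e -> eta = Num.min v^-1 e ->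
  [/\ 0 < eta, eta * v <= 1, eta <= e & eta^-1 <= v + e^-1].
Proof.
move=> v0 e0 ->; have vi0 : 0 < v^-1 by rewrite invr_gt0.
have ei0 : 0 < e^-1 by rewrite invr_gt0.
split; first by rewrite lt_min vi0.
- by rewrite -ler_pdivlMr// div1r ge_min lexx.
- by rewrite ge_min lexx orbT.
by case: (leP v^-1 e) => _; rewrite ?invrK ?lerDl ?lerDr ltW.
Qed.

Lemma min6V (v1 v2 v3 v4 v5 v6 eta : R) :
  0 < v1 -> 0 < v2 -> 0 < v3 -> 0 < v4 -> 0 < v5 -> 0 < v6 ->
  eta = Num.min v1^-1 (Num.min v2^-1 (Num.min v3^-1
    (Num.min v4^-1 (Num.min v5^-1 v6^-1)))) ->
  [/\ 0 < eta, [/\ eta * v1 <= 1, eta * v2 <= 1 & eta * v3 <= 1],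
    [/\ eta * v4 <= 1, eta * v5 <= 1 & eta * v6 <= 1]
    & eta^-1 <= v1 + v2 + v3 + v4 + v5 + v6].
Proof.
move=> p1 p2 p3 p4 p5 p6.
have p6' : 0 < v6^-1 by rewrite invr_gt0.
have [q5 a5 b5 c5] := minV_step p5 p6' erefl.
have [q4 a4 b4 c4] := minV_step p4 q5 erefl.
have [q3 a3 b3 c3] := minV_step p3 q4 erefl.
have [q2 a2 b2 c2] := minV_step p2 q3 erefl.
move=> /(minV_step p1 q2) [q1 a1 b1 c1].
rewrite invrK in c5.
have le_mul (v x y : R) : 0 < v -> x <= y -> y * v <= 1 -> x * v <= 1.
  by move=> v0 xy; apply: le_trans; rewrite ler_pM2r.
have d3 := le_trans b1 b2; have d4 := le_trans d3 b3; have d5 := le_trans d4 b4.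
split => //.
- by split=> //; [exact: le_mul b1 _|exact: le_mul d3 _].
- split; [exact: le_mul d4 _|exact: le_mul d5 _|].
  by apply: (le_mul _ _ v6^-1) => //; [exact: le_trans d5 b5|rewrite mulVf// gt_eqF].
by move: c1 c2 c3 c4 c5; lra.
Qed.

(** The energy inequality is multiplied by [4 / (eta T)]. The inverse of [eta] left on [D1] is
    bounded by the sum [hI]; the factor [eta] left on the terms in [A] and [C] is traded for
    [1 / sqrt T] through [hA] and [hC]. *)
Lemma average_bound (sT sH sA sC B D1 Dc eta S b2 l e5 e6 cG : R) :
  0 < sT -> 0 <= sH -> 0 <= sA -> 0 <= sC -> 0 < eta -> 0 <= D1 -> 0 <= Dc ->
  eta / 4 * S <= D1 + 4 * sH ^+ 2 * eta ^+ 2 * (sA ^+ 2 * Dc + sC ^+ 2) * sT ^+ 2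
    + 3 * eta * b2 * l ->
  eta * (4 * (sH * sA) * sT) <= 1 -> eta * (2 * (sH * sC) * sT) <= 1 ->
  eta^-1 <= 4 * (sH * sA) * sT + 8 * sH ^+ 2 * (B + 1) + 2 * (sH * sC) * sT + cG + e5 + e6 ->
  1 / sT ^+ 2 * S <= 4 / sT * sH * (sA * (Dc + 4 * D1) + 2 * sC * (1 + D1))
    + 32 * D1 / sT ^+ 2 * sH ^+ 2 * (B + 1) + 4 * D1 / sT ^+ 2 * (e5 + e6)
    + 4 * D1 / sT ^+ 2 * cG + 12 / sT ^+ 2 * b2 * l.
Proof.
move=> sT0 sH0 sA0 sC0 eta0 D10 Dc0 hS hA hC hI.
set it := sT^-1; have it0 : 0 < it by rewrite invr_gt0.
have itT : it * sT = 1 by rewrite mulVf// gt_eqF.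
set k := eta^-1 in hI; have k0 : 0 < k by rewrite invr_gt0.
have ke : k * eta = 1 by rewrite mulVf// gt_eqF.
have -> : 1 / sT ^+ 2 = it ^+ 2 by rewrite div1r exprVn.
have -> : 32 * D1 / sT ^+ 2 = 32 * D1 * it ^+ 2 by rewrite exprVn.
have -> : 4 * D1 / sT ^+ 2 = 4 * D1 * it ^+ 2 by rewrite exprVn.
have -> : 12 / sT ^+ 2 = 12 * it ^+ 2 by rewrite exprVn.
rewrite -/it.
have h1 : S <= 4 * D1 * k + 16 * sH ^+ 2 * eta * (sA ^+ 2 * Dc + sC ^+ 2) * sT ^+ 2 + 12 * b2 * l.
  have := ler_wpM2l (ltW (mulr_gt0 (ltr0n R 4) k0)) hS.
  have -> : 4 * k * (eta / 4 * S) = k * eta * S by field.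
  have -> : 4 * k * (D1 + 4 * sH ^+ 2 * eta ^+ 2 * (sA ^+ 2 * Dc + sC ^+ 2) * sT ^+ 2
      + 3 * eta * b2 * l) = 4 * D1 * k
      + 16 * sH ^+ 2 * (k * eta * eta) * (sA ^+ 2 * Dc + sC ^+ 2) * sT ^+ 2
      + 12 * (k * eta) * b2 * l by ring.
  by rewrite ke !mul1r mulr1.
have h2 := ler_wpM2l (sqr_ge0 it) h1.
have h3 : 16 * sH ^+ 2 * eta * (sA ^+ 2 * Dc) <= 4 * it * (sH * sA * Dc).
  have := ler_wpM2l (_ : 0 <= 4 * it * (sH * sA * Dc)) hA; rewrite mulr1 => /(_ _).
  have -> : 4 * it * (sH * sA * Dc) * (eta * (4 * (sH * sA) * sT)) =
    16 * sH ^+ 2 * eta * (sA ^+ 2 * Dc) * (it * sT) by ring.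
  by rewrite itT mulr1; apply; rewrite !mulr_ge0// ltW.
have h4 : 16 * sH ^+ 2 * eta * (sC ^+ 2) <= 8 * it * (sH * sC).
  have := ler_wpM2l (_ : 0 <= 8 * it * (sH * sC)) hC; rewrite mulr1 => /(_ _).
  have -> : 8 * it * (sH * sC) * (eta * (2 * (sH * sC) * sT)) =
    16 * sH ^+ 2 * eta * (sC ^+ 2) * (it * sT) by ring.
  by rewrite itT mulr1; apply; rewrite !mulr_ge0// ltW.
have h5 : it ^+ 2 * (16 * sH ^+ 2 * eta * (sA ^+ 2 * Dc + sC ^+ 2) * sT ^+ 2) =
    16 * sH ^+ 2 * eta * (sA ^+ 2 * Dc) + 16 * sH ^+ 2 * eta * (sC ^+ 2).
  transitivity (16 * sH ^+ 2 * eta * (sA ^+ 2 * Dc + sC ^+ 2) * (it * sT) ^+ 2); first by ring.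
  by rewrite itT expr1n; ring.
have h6 := ler_wpM2l (mulr_ge0 (mulr_ge0 (ler0n R 4) D10) (sqr_ge0 it)) hI.
have e1 : 4 * D1 * it ^+ 2 * (4 * (sH * sA) * sT + 8 * sH ^+ 2 * (B + 1)
    + 2 * (sH * sC) * sT + cG + e5 + e6)
  = 16 * D1 * it * (it * sT) * (sH * sA) + 32 * D1 * it ^+ 2 * sH ^+ 2 * (B + 1)
    + 8 * D1 * it * (it * sT) * (sH * sC) + 4 * D1 * it ^+ 2 * (cG + e5 + e6) by ring.
rewrite e1 itT !mulr1 in h6.
lra.
Qed.

Lemma powR_half (x : R) : 0 < x -> x `^ (1 / 2) = Num.sqrt x.
Proof. by move=> x0; rewrite div1r powR12_sqrt// ltW. Qed.

Lemma powR_three_halves (x : R) : 0 < x -> x `^ (3 / 2) = x * Num.sqrt x.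
Proof.
move=> x0; have -> : 3 / 2 = 1 + 1 / 2 :> R by lra.
by rewrite powRD ?(gt_eqF x0) ?implybT// powRr1 ?(ltW x0)// powR_half.
Qed.

End numeric.

Unset Implicit Arguments.
Set Strict Implicit.

Theorem theorem1 (R : realType) (d : nat)
  (dZ : measure_display) (Z : measurableType dZ) (D : probability Z R)
  (dO : measure_display) (Omega : measurableType dO) (P : probability Omega R)
  (T : nat) (hT : (1 <= T)%N)
  (delta : R) (hdelta : 0 < delta < 1)
  (fz : 'rV[R]_d -> Z -> R) (f : 'rV[R]_d -> R)
  (hfz : forall (z : Z) (x : 'rV[R]_d), differentiable (fz ^~ z) x)
  (hf : forall x : 'rV[R]_d, is_expectation D (fz x) (f x))
  (hdf : forall x : 'rV[R]_d, differentiable f x)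
  (L0 L1 : R) (hL0 : 0 < L0) (hL1 : 0 < L1)
  (hsmooth : L0L1_smooth L0 L1 f)
  (A B C : R) (hA : 0 < A) (hB : 0 < B) (hC : 0 < C)
  (hbelow : has_lbound (range f))
  (hunbiased : unbiased_oracle D fz f)
  (hvar : relaxed_affine_variance D A B C fz f)
  (z : nat -> {RV P >-> Z}) (hz : iid_samples D T z)
  (x1 : 'rV[R]_d) (alpha theta gamma : nat -> R) :
  let Tr : R := T%:R in
  let Delta1 := f x1 - inf (range f) in
  let Deltac := 8 * Delta1 + 8 + 32 * ln (Tr / delta) ^+ 2
    + 8 * Num.sqrt (2 * C) / Num.sqrt (L0 * Tr) * ln (Tr / delta)
    + (303 * L0) / (224 * L1 ^+ 2) in
  let sigma := Num.sqrt (L0 * Deltac + L1 ^+ 2 * Deltac ^+ 2) in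
  let Mc := L0 / (8 * L1) + 9 / 4 * sigma in
  let cA := 4 * Num.sqrt ((L0 + L1 * Mc) * A) in
  let cB := 8 * (L0 + L1 * Mc) * (B + 1) in
  let cC := 2 * Num.sqrt ((L0 + L1 * Mc) * C) in
  let cG := 8 * L1 *
    (Num.sqrt (A * Deltac) + 2 * (Num.sqrt B + 1) * sigma + Num.sqrt C) in
  let eta :=
    Num.min (1 / (cA * Num.sqrt Tr))
   (Num.min (1 / cB)
   (Num.min (1 / (cC * Num.sqrt Tr))
   (Num.min (1 / cG)
   (Num.min (Deltac `^ (- (1 / 2)) / (3 * (A + 4 * B * L0)))
            (Deltac `^ (- (3 / 2)) / (12 * B * L1 ^+ 2)))))) in
  let xbar (w : Omega) (t : nat) : 'rV[R]_d :=
    agd_xbar (fun x s => grad (fz ^~ s) x) x1 alpha theta gamma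
      (fun k => z k w) t in
  sgd_params T eta alpha theta gamma \/ rsag_params T eta alpha theta gamma ->
  ((1 - delta)%:E <= P [set w : Omega |
    (1 / Tr * \sum_(1 <= t < T.+1) enorm (grad f (xbar w t)) ^+ 2 <=
      4 / Num.sqrt Tr * Num.sqrt (L0 + L1 * Mc) *
        (Num.sqrt A * (Deltac + 4 * Delta1)
         + 2 * Num.sqrt C * (1 + Delta1))
      + 32 * Delta1 / Tr * (L0 + L1 * Mc) * (B + 1)
      + 12 * Delta1 / Tr *
        ((A + 4 * B * L0) * Deltac `^ (1 / 2)
         + 4 * B * L1 ^+ 2 * Deltac `^ (3 / 2))
      + 32 * Delta1 / Tr * L1 *
        (Num.sqrt (A * Deltac) + 2 * (Num.sqrt B + 1) * sigma + Num.sqrt C)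
      + 12 / Tr *
        (A * Deltac + 4 * B * (L0 * Deltac + L1 ^+ 2 * Deltac ^+ 2) + C)
        * ln (Tr / delta))%R])%E.
Proof.
move=> Tr Delta1 Deltac sigma Mc cA cB cC cG eta xbar hparams.
set m := inf (range f) in Delta1 Deltac sigma Mc cA cB cC cG eta hparams *.
have f_ge (x : 'rV[R]_d) : m <= f x by apply: ge_inf => //; exists x.
have mfz x : measurable_fun setT (fz x).
  by have [i _] := hf x; apply/measurable_EFinP; case/integrableP: i.
have /andP[delta0 delta1] := hdelta.
have Tr_ge1 : 1 <= Tr by rewrite ler1n.
have Tr0 : 0 < Tr by exact: lt_le_trans Tr_ge1.
set l := ln (Tr / delta).
have l0 : 0 <= l by rewrite ln_ge0// ler_pdivlMr// mul1r (le_trans (ltW delta1)).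
have D10 : 0 <= Delta1 by rewrite subr_ge0.
pose q := Num.sqrt (2 * C) / Num.sqrt (L0 * Tr).
have q0 : 0 <= q by rewrite divr_ge0 ?sqrtr_ge0.
have qE : q ^+ 2 * (L0 * Tr) = 2 * C.
  have h : 0 < L0 * Tr by rewrite mulr_gt0.
  rewrite /q expr_div_n !sqr_sqrtr ?(ltW h) ?mulr_ge0 ?(ltW hC)// divfK// gt_eqF//.
have DcE : Deltac = 8 * Delta1 + 8 + 32 * l ^+ 2 + 8 * q * l + 303 * L0 / (224 * L1 ^+ 2).
  by rewrite /Deltac /q /l !mulrA.
have Dc0 : 0 < Deltac.
  have h : 0 <= 303 * L0 / (224 * L1 ^+ 2).
    by apply: divr_ge0; apply: mulr_ge0 => //; [exact: ltW|exact: sqr_ge0].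
  rewrite DcE; have := mulr_ge0 q0 l0; have := sqr_ge0 l; lra.
set s2 := L0 * Deltac + L1 ^+ 2 * Deltac ^+ 2.
have s20 : 0 <= s2.
  by apply: addr_ge0; [|rewrite mulr_ge0 ?sqr_ge0//]; rewrite mulr_ge0// ltW.
have sigma0 : 0 <= sigma by exact: sqrtr_ge0.
pose H := L0 + L1 * Mc.
have H0 : 0 < H.
  apply: ltr_wpDr => //; apply: mulr_ge0; first exact: ltW.
  apply: addr_ge0; last exact: mulr_ge0.
  by rewrite divr_ge0 ?mulr_ge0// ltW.
pose r := Num.sqrt Deltac.
have r0 : 0 < r by rewrite sqrtr_gt0.
pose sT := Num.sqrt Tr; pose sH := Num.sqrt H; pose sA := Num.sqrt A; pose sC := Num.sqrt C.
have sT0 : 0 < sT by rewrite sqrtr_gt0.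
have sH0 : 0 < sH by rewrite sqrtr_gt0.
have sA0 : 0 < sA by rewrite sqrtr_gt0.
have sC0 : 0 < sC by rewrite sqrtr_gt0.
have sTE : sT ^+ 2 = Tr by rewrite sqr_sqrtr// ltW.
have sHE : sH ^+ 2 = H by rewrite sqr_sqrtr// ltW.
have sAE : sA ^+ 2 = A by rewrite sqr_sqrtr// ltW.
have sCE : sC ^+ 2 = C by rewrite sqr_sqrtr// ltW.
have cAE : cA = 4 * (sH * sA) by rewrite /cA sqrtrM// ltW.
have cCE : cC = 2 * (sH * sC) by rewrite /cC sqrtrM// ltW.
pose e5 := 3 * (A + 4 * B * L0) * r.
pose e6 := 12 * B * L1 ^+ 2 * (Deltac * r).
have cG0 : 0 < cG.
  rewrite /cG !mulr_gt0// ltr_wpDl// addr_ge0 ?sqrtr_ge0//.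
  by rewrite mulr_ge0// mulr_ge0// addr_ge0// sqrtr_ge0.
have e50 : 0 < e5 by rewrite !mulr_gt0// addr_gt0// !mulr_gt0.
have e60 : 0 < e6 by rewrite !mulr_gt0// exprn_gt0.
have etaE : eta = Num.min (cA * sT)^-1 (Num.min cB^-1 (Num.min (cC * sT)^-1
    (Num.min cG^-1 (Num.min e5^-1 e6^-1)))).
  rewrite /eta !div1r; congr (Num.min _ (Num.min _ (Num.min _ (Num.min _ (Num.min _ _))))).
    by rewrite powRN powR12_sqrt ?(ltW Dc0)// /e5 [in RHS]invfM mulrC.
  by rewrite powRN powR_three_halves// /e6 [in RHS]invfM mulrC.
have cA0 : 0 < cA * sT by rewrite cAE !mulr_gt0.
have cB0 : 0 < cB by rewrite /cB; apply: mulr_gt0; [exact: mulr_gt0|exact: addr_gt0].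
have cC0 : 0 < cC * sT by rewrite cCE !mulr_gt0.
have [eta0 [etaA etaB etaC] [etaG eta5 eta6] etaI] := min6V cA0 cB0 cC0 cG0 e50 e60 etaE.
have etaA2 : 16 * H * A * Tr * eta ^+ 2 <= 1.
  have -> : 16 * H * A * Tr * eta ^+ 2 = (eta * (cA * sT)) ^+ 2.
    by rewrite cAE -sHE -sAE -sTE; ring.
  by rewrite expr_le1// mulr_ge0// ltW.
have etaC2 : 4 * H * C * Tr * eta ^+ 2 <= 1.
  have -> : 4 * H * C * Tr * eta ^+ 2 = (eta * (cC * sT)) ^+ 2.
    by rewrite cCE -sHE -sCE -sTE; ring.
  by rewrite expr_le1// mulr_ge0// ltW.
have grad_le x : f x - m <= Deltac -> enorm (grad f x) ^+ 2 <= 4 * s2.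
  move=> /(grad_le_gap hdf hL0 hL1 hsmooth f_ge D10 l0 q0 DcE) h.
  have -> : 4 * s2 = (2 * sigma) ^+ 2 by rewrite exprMn (_ : sigma ^+ 2 = s2) ?sqr_sqrtr//; ring.
  by apply: lerXn2r => //; rewrite nnegrE ?enorm_ge0// mulr_ge0.
have hv x : {ae D, forall y, variance_cond fz f A B C m x y} by exact: hvar.
pose G x y := grad (fz ^~ y) x.
(* [b] is [(gamma - eta) / eta]: zero for SGD, [alpha] for RSAG. *)
pose b n := if `[< sgd_params T eta alpha theta gamma >] then 0 else alpha n.+1.
have hab : (forall n, (n < T)%N -> 0 < alpha n.+1 <= 1 /\ b n = 0) \/
  (forall n, (n < T)%N -> alpha n.+1 = 2 / (n%:R + 2) /\ b n = alpha n.+1).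
  rewrite /b; case: asboolP => hs.
    by left=> n nT; have [] := hs n.+1 nT.
  right=> n nT; case: hparams => // hr; have [-> _ _] := hr n.+1 nT.
  split=> //; rewrite -[n.+1%:R]natr1; congr (_ / _); ring.
have htheta n : (n < T)%N -> theta n.+1 = eta.
  by move=> nT; case: hparams => /(_ n.+1 nT) [].
have hgamma n : (n < T)%N -> gamma n.+1 - eta = b n * eta.
  move=> nT; rewrite /b; case: asboolP => hs.
    by have [_ _ ->] := hs n.+1 nT; rewrite subrr mul0r.
  case: hparams => // hr; have [_ <- ->] := hr n.+1 nT.
  by rewrite mulrDl mul1r addrAC subrr add0r.
set E := [set w | _].
have mE : measurable E.
  have mS : measurable_fun setT (fun w =>
      1 / Tr * \sum_(1 <= t < T.+1) enorm (grad f (xbar w t)) ^+ 2).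
    apply: measurable_funM => //; under eq_fun do rewrite big_add1 big_mkord.
    apply: measurable_sum => k; apply: measurable_grad_sqr => //.
    apply: (@measurable_xbar _ _ _ _ _ mfz hfz x1 alpha theta gamma _ Omega
      (fun j w => z j w) T) => //.
    exact: (ltnW (ltn_ord k)).
  have mle c : measurable [set w |
      1 / Tr * \sum_(1 <= t < T.+1) enorm (grad f (xbar w t)) ^+ 2 <= c].
    have /(_ measurableT [set true] I) := measurable_fun_ler mS (measurable_cst c).
    by rewrite setTI.
  exact: mle.
(* The loss of the union bound, for [l = ln (T / delta)]. *)
have -> : delta = T%:R * expR (- l).
  rewrite expRN lnK ?posrE ?divr_gt0// invf_div mulrC divfK//.
  by rewrite gt_eqF.
apply: (high_probability mfz hfz hdf hunbiased (ltW hA) (ltW hB) hC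
  (ltW Dc0) s20 grad_le hv hz mE) => w hvc hS.
(* Indices now start at 0: [(s n).1], [xb n] and [g n] carry the index [n + 1] in the algorithm. *)
pose s n := agd_iter G x1 alpha theta gamma (fun j => z j w) n.
pose xb n := xbar w n.+1.
pose g n := G (xb n) (z n.+1 w).
have xbE n : (n < T)%N -> xb n = (s n).1 + (1 - alpha n.+1) *: ((s n).2 - (s n).1).
  move=> _; have -> : xb n = alpha n.+1 *: (s n).1 + (1 - alpha n.+1) *: (s n).2 by [].
  by apply/rowP => i; rewrite !mxE; ring.
have xS n : (n < T)%N -> (s n.+1).1 = (s n).1 - eta *: g n.
  by move=> nT; rewrite -(htheta n nT).
have DS n : (n < T)%N -> (s n.+1).2 - (s n.+1).1 =
    (1 - alpha n.+1) *: ((s n).2 - (s n).1) - (b n * eta) *: g n.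
  move=> nT; rewrite xS// -hgamma//.
  have -> : (s n.+1).2 = xb n - gamma n.+1 *: g n by [].
  rewrite xbE//; move: (s n) (g n) => s' g'.
  by apply/rowP => i; rewrite !mxE; ring.
have etaB' : 8 * H * (B + 1) * eta <= 1 by rewrite mulrC.
have etaG' : cG * eta <= 1 by rewrite mulrC.
have eta5' : 3 * (A + 4 * B * L0) * eta * r <= 1 
  by rewrite (_ : _ * r = eta * e5)// /e5; ring.
have eta6' : 12 * B * L1 ^+ 2 * Deltac * r * eta <= 1 
  by rewrite (_ : _ * eta = eta * e6)// /e6; ring.
have hsum := sum_grad_le hdf hL0 hL1 hA hB hC hsmooth f_ge hT D10 l0 q0 qE DcE eta0 etaA2
  etaB' etaC2 etaG' eta5' eta6' (x := fun n => (s n).1) (xb := xb)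
  (D := fun n => (s n).2 - (s n).1) (g := g) (a := fun n => alpha n.+1) (b := b)
  erefl xS xbE (subrr _) DS hab hvc hS.
rewrite /E/= big_add1 big_mkord powR_half// powR_three_halves//.
set b2 := A * Deltac + 4 * B * s2 + C.
have avg := @average_bound R sT sH sA sC B Delta1 Deltac eta
  (\sum_(k < T) enorm (grad f (xb k)) ^+ 2) b2 l e5 e6 cG sT0 (ltW sH0) (ltW sA0) (ltW sC0)
  eta0 D10 (ltW Dc0).
rewrite sTE sHE sAE sCE -cAE -cCE in avg.
apply: le_trans (avg hsum etaA etaC etaI) _.
(* Both sides now agree: [4 (e5 + e6)] and [4 cG] supply the factors 12 and 32 of the claim. *)
rewrite /e5 /e6 /cG -/sA -/sC -/sT -/r -/H -/sH -/l; set G0 := _ + _ + Num.sqrt C.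
rewrite le_eqVlt; apply/orP; left; apply/eqP; ring.
Qed.
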